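(* Let $(\epsilon(n))_{n\ge 1}$ be a sequence of positive real numbers with $\epsilon(n)\to 0$ as $n\to\infty$. Then there exists a Menshov spectrum $\Lambda\subset\mathbb{Z}$ that is symmetric (i.e. $-\Lambda=\Lambda$) and whose positive elements $\lambda(1)<\lambda(2)<\lambda(3)<\cdots$ satisfy $$\frac{\lambda(n+1)}{\lambda(n)}>1+\epsilon(n)\qquad\text{for all } n=1,2,\ldots$$
   Context: $\mathbb{T}=\mathbb{R}/2\pi\mathbb{Z}$, and $L^0(\mathbb{T})$ is the space of all measurable functions $f:\mathbb{T}\to\mathbb{C}$ (with respect to Lebesgue measure). A set $\Lambda\subset\mathbb{Z}$ is called a Menshov spectrum if for every $f\in L^0(\mathbb{T})$ there are complex coefficients $(c_k)_{k\in\Lambda}$ such that $f(t)=\lim_{N\to\infty}\sum_{k\in\Lambda,\,|k|\le N}c_k e^{ikt}$ for almost every $t\in\mathbb{T}$. *)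

(* Defs.v *)
From mathcomp Require Import all_boot all_order all_algebra.
From mathcomp Require Import all_classical all_reals all_analysis.
From mathcomp Require Export complex.

Set Implicit Arguments.
Unset Strict Implicit.
Unset Printing Implicit Defensive.
Import Order.TTheory GRing.Theory Num.Theory.
Import numFieldNormedType.Exports.

Local Open Scope classical_set_scope.
Local Open Scope ring_scope.
Local Open Scope complex_scope.

(* [caratheodory_type] carries the sigma-algebra of all Lebesgue measurable
   sets, not just the Borel sets; its underlying type is R itself. *)
Definition lebesgueR (R : realType) :=
  caratheodory_type (lebesgue_stieltjes_measure.wlength (R := R) idfun)^*%mu.

(* The complex plane with its Borel sigma-algebra. The topology on [R[i]^o] is
   that of the modulus. *)
Definition borelC (R : realType) := g_sigma_algebraType (@open R[i]^o).

(* A function on R / 2 pi Z is represented by its 2 pi-periodic lift to R.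
   The null sets of the quotient are those whose (periodic) preimage in R is
   a null set, so "almost everywhere" can be read on R. *)
Definition L0 (R : realType) : set (R -> R[i]) :=
  [set f | periodic f (pi *+ 2) /\
           measurable_fun setT (f : lebesgueR R -> borelC R)].

Definition expi (R : realType) (x : R) : R[i] := cos x +i* sin x.

(* The index set is finite for each N, so this [\sum_(_ \in _)] is a genuine
   finite sum. *)
Definition partial_sum (R : realType) (L : set int) (c : int -> R[i])
    (N : nat) (t : R) : R[i]^o :=
  \sum_(k \in [set k : int | L k /\ (`|k| <= N)%N]) c k * expi (k%:~R * t).

Definition menshov_spectrum (R : realType) (L : set int) : Prop :=
  forall f : R -> R[i], L0 f ->
  exists c : int -> R[i],
    \forall t \ae (@completed_lebesgue_measure R),
      partial_sum L c ^~ t @ \oo --> (f t : R[i]^o).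

(* Main.v *)
(* The spectrum is made of blocks {+-(b n + sigma(n)) : 1 <= n <= D}, where the
   shifts sigma depend on the block only and b may be taken as large as we like:
   once eps < 1/(4D), such a block obeys the gap condition. It carries the
   polynomials P(t) = Q'(t) R(bHt), with the following ingredients.
   - Q'(t) = sum_s q_s e^(ist) g_s(e^(ibt)) is close to a given trigonometric
     polynomial Q(t) = sum_s q_s e^(ist), because the g_s are analytic
     polynomials that vanish at 0 but are close to 1 off a small subset of the
     circle. They have disjoint spectra, so every n receives a single shift;
     being analytic, they never use both n and -n, so symmetry costs nothing.
   - R is an average of M dilates of 1 - (Fejer's kernel) with disjoint spectra:
     it has no constant term, its coefficients are at most 1/M, it is close to 1
     off a set of measure mu, and its partial sums are O(1/mu) there.
   As Q' is a common factor, the partial sums of P are Q' times those of R, up to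
   O(1/M). So P is as close to Q as we like, while off a set of measure mu its
   partial sums are at most C(mu) |Q|, where C(mu) does not depend on how close
   P is to Q. A measurable f is then expanded step by step: the k-th remainder is
   small compared with 1/C(2^-k) off a set of measure O(2^-k), and Borel-Cantelli
   gives convergence almost everywhere. *)
From HB Require Import structures.
Require Import Defs.
From mathcomp Require Import all_boot all_order all_algebra.
From mathcomp Require Import all_classical all_reals all_analysis.
From mathcomp Require Import measurable_realfun zify ring lra.
Set Implicit Arguments.
Unset Strict Implicit.
Unset Printing Implicit Defensive.
Import Order.TTheory GRing.Theory Num.Theory.
Import numFieldNormedType.Exports.
Local Open Scope classical_set_scope.
Local Open Scope ring_scope.

(* The modulus with values in R; the norm `|z| of R[i] has values in R[i]. *)
Notation cabs := (@Normc.normc _).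

(** * Complex exponentials and Fejer's kernel *)

Section ComplexModulus.
Local Open Scope complex_scope.
Variable R : realType.
Implicit Types (x y z : R[i]).

Lemma cabsE z : `|z| = (cabs z)%:C.
Proof. by []. Qed.

Lemma cabs_ge0 z : 0 <= cabs z.
Proof. by case: z => a b; exact: sqrtr_ge0. Qed.

Lemma cabs0 : cabs (0 : R[i]) = 0.
Proof. exact: Normc.normc0. Qed.

Lemma cabs1 : cabs (1 : R[i]) = 1.
Proof. exact: Normc.normc1. Qed.

Lemma cabsM x y : cabs (x * y) = cabs x * cabs y.
Proof. exact: Normc.normcM. Qed.

Lemma cabsD x y : cabs (x + y) <= cabs x + cabs y.
Proof. exact: le_normcD. Qed.

Lemma cabsN x : cabs (- x) = cabs x.
Proof. exact: normcN. Qed.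

Lemma cabsB x y : cabs (x - y) <= cabs x + cabs y.
Proof. by rewrite -(cabsN y); exact: cabsD. Qed.

Lemma cabs_distC x y : cabs (x - y) = cabs (y - x).
Proof. by rewrite -cabsN opprB. Qed.

Lemma cabs_sub_trans y x z : cabs (x - z) <= cabs (x - y) + cabs (y - z).
Proof. by rewrite (_ : x - z = (x - y) + (y - z)) ?cabsD//; ring. Qed.

Lemma cabs_le_dist x y : cabs x <= cabs y + cabs (x - y).
Proof. by rewrite -{1}(subrK y x) addrC; exact: cabsD. Qed.

Lemma cabs_real (r : R) : cabs r%:C = `|r|.
Proof. by rewrite /= expr0n /= addr0 sqrtr_sqr. Qed.

Lemma cabsX x n : cabs (x ^+ n) = cabs x ^+ n.
Proof. by elim: n => [|n ih]; rewrite ?expr0 ?cabs1// !exprS cabsM ih. Qed.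

Lemma cabsJ x : cabs (conjc x) = cabs x.
Proof. by case: x => a b /=; rewrite sqrrN. Qed.

Lemma cabs_sum (I : Type) (r : seq I) (P : pred I) (F : I -> R[i]) :
  cabs (\sum_(i <- r | P i) F i) <= \sum_(i <- r | P i) cabs (F i).
Proof.
elim/big_rec2: _ => [|i y x _ ih]; first by rewrite cabs0.
by rewrite (le_trans (cabsD _ _))// lerD2l.
Qed.

Lemma mulcJ_cabs x : x * (conjc x) = (cabs x ^+ 2)%:C.
Proof. by rewrite rmorphXn /= -cabsE sqr_normc. Qed.

Lemma expiD (a b : R) : expi (a + b) = expi a * expi b.
Proof. by rewrite /expi cosD sinD [X in _ +i* X]addrC. Qed.

Lemma expi0 : expi (0 : R) = 1.
Proof. by rewrite /expi cos0 sin0. Qed.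

Lemma expiN (a : R) : expi (- a) = (conjc (expi a)).
Proof. by rewrite /expi cosN sinN. Qed.

Lemma cabs_expi (a : R) : cabs (expi a) = 1.
Proof. by rewrite /= cos2Dsin2 sqrtr1. Qed.

Lemma expiMn n (a : R) : expi (n%:R * a) = expi a ^+ n.
Proof.
elim: n => [|n ih]; first by rewrite mul0r expi0.
by rewrite exprS -ih -expiD -natr1 mulrDl mul1r addrC.
Qed.

Lemma expi_cos n (a : R) :
  expi a ^+ n + (conjc (expi a)) ^+ n = (cos (n%:R * a) *+ 2)%:C.
Proof.
rewrite -rmorphXn /= -expiMn /expi; apply/eqP.
by rewrite eq_complex /= mulr2n subrr !eqxx.
Qed.

End ComplexModulus.

Section Fejer.
Local Open Scope complex_scope.
Variable R : realType.
Implicit Types (z : R[i]) (L n k : nat).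

(** Natural subtraction truncates, so the weight is 0 for [k > L], and [fejer_partial L K] is
    constant from [K = L] on. *)
Definition fejer_weight L k : R := (L.+1 - k)%:R / L.+1%:R.

Definition fejer_partial L K z : R[i] :=
  \sum_(1 <= k < K.+1) (fejer_weight L k)%:C * z ^+ k.

Definition fejer L z : R[i] := 1 + (fejer_partial L L z + fejer_partial L L (conjc z)).

Lemma fejer_weight_bound L k : 0 <= fejer_weight L k <= 1.
Proof.
rewrite /fejer_weight divr_ge0//= ler_pdivrMr ?ltr0n// mul1r ler_nat.
exact: leq_subr.
Qed.

Lemma fejer_weight_gt L k : (L < k)%N -> fejer_weight L k = 0.
Proof. by move=> Lk; rewrite /fejer_weight (eqP (_ : L.+1 - k == 0)%N) ?mul0r// subn_eq0. Qed.

Lemma fejer_weight0 L : fejer_weight L 0 = 1.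
Proof. by rewrite /fejer_weight subn0 divff// pnatr_eq0. Qed.

Lemma fejer_weightS L k : fejer_weight L k.+1 <= fejer_weight L k.
Proof.
by rewrite /fejer_weight ler_pM2r ?invr_gt0 ?ltr0n// ler_nat leq_sub2l.
Qed.

Lemma fejer_partial_gt L K z : (L <= K)%N -> fejer_partial L K z = fejer_partial L L z.
Proof.
move=> LK; rewrite /fejer_partial (@big_cat_nat _ _ _ L.+1)//=.
rewrite [X in _ + X]big_nat_cond [X in _ + X]big1 ?addr0// => k.
by rewrite andbT => /andP[? _]; rewrite fejer_weight_gt// mul0r.
Qed.

(** Induction on [n]: as z times its conjugate is 1, the new cross terms are reflected geometric
    sums, which raise every coefficient [n - k] by one. *)
Lemma geom_sqr n z : cabs z = 1 ->
  (\sum_(k < n) z ^+ k) * (conjc (\sum_(k < n) z ^+ k)) =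
  n%:R + \sum_(1 <= k < n) ((n - k)%:R * (z ^+ k + (conjc z) ^+ k)).
Proof.
move=> z1; have zJ : z * (conjc z) = 1 by rewrite mulcJ_cabs z1 expr1n.
elim: n => [|n ih]; first by rewrite !big_ord0 mul0r big_geq// addr0.
have key (u v : R[i]) : u * v = 1 ->
    (\sum_(k < n) u ^+ k) * v ^+ n = \sum_(1 <= k < n.+1) v ^+ k.
  move=> uv; rewrite -(big_mkord xpredT (fun k => u ^+ k)) mulr_suml.
  rewrite big_nat_rev /= add0n big_add1 /= big_nat_cond [RHS]big_nat_cond.
  apply: eq_bigr => k /andP[/andP[_ kn] _].
  rewrite -[X in v ^+ X](subnK kn) exprD mulrA -exprMn uv expr1n mul1r.
  by [].
rewrite big_ord_recr /= rmorphD /= rmorphXn /=.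
rewrite mulrDl 2!mulrDr -exprMn zJ expr1n ih key//.
rewrite [X in z ^+ n * X](_ : _ = \sum_(k < n) (conjc z) ^+ k); last first.
  by rewrite rmorph_sum /=; apply: eq_bigr => k _; rewrite rmorphXn.
rewrite (mulrC (z ^+ n)) key; last by rewrite mulrC.
have -> : \sum_(1 <= k < n.+1) ((n.+1 - k)%:R * (z ^+ k + (conjc z) ^+ k)) =
    \sum_(1 <= k < n) ((n - k)%:R * (z ^+ k + (conjc z) ^+ k)) +
    (\sum_(1 <= k < n.+1) z ^+ k + \sum_(1 <= k < n.+1) (conjc z) ^+ k).
  rewrite -big_split /=.
  case: n {ih key} => [|n]; first by rewrite !big_geq// addr0.
  have -> : \sum_(1 <= k < n.+1) ((n.+1 - k)%:R * (z ^+ k + (conjc z) ^+ k)) =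
      \sum_(1 <= k < n.+2) ((n.+1 - k)%:R * (z ^+ k + (conjc z) ^+ k)).
    by rewrite [RHS]big_nat_recr//= subnn mul0r addr0.
  rewrite -big_split /=; apply: eq_big_nat => k /andP[_ kn].
  by rewrite subSn// -natr1 mulrDl mul1r.
rewrite -natr1; ring.
Qed.

(** This makes Fejer's kernel real and nonnegative on the circle, as both the measure estimate
    [off_near1] and the interpolation require. *)
Lemma fejerE L z : cabs z = 1 ->
  fejer L z = (cabs (\sum_(k < L.+1) z ^+ k) ^+ 2 / L.+1%:R)%:C.
Proof.
move=> z1; rewrite rmorphM /= -mulcJ_cabs geom_sqr// fmorphV rmorph_nat.
rewrite mulrDl divff ?pnatr_eq0// /fejer; congr (_ + _).
rewrite /fejer_partial -big_split mulr_suml; apply: eq_bigr => k _ /=.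
rewrite -mulrDr /fejer_weight rmorphM /= fmorphV !rmorph_nat; ring.
Qed.

Lemma cabs_geom n z : cabs z = 1 ->
  cabs (1 - z) * cabs (\sum_(k < n) z ^+ k) <= 2.
Proof.
move=> z1; rewrite -cabsM -cabsN -mulNr opprB -subrX1 (le_trans (cabsB _ _))//.
by rewrite cabsX z1 expr1n cabs1.
Qed.

Lemma cabs_geom_near1 n z : cabs z = 1 -> n%:R * cabs (1 - z) <= 1 ->
  n%:R / 2 <= cabs (\sum_(k < n) z ^+ k).
Proof.
move=> z1 nz; set d := cabs (1 - z) in nz.
have powd k : cabs (1 - z ^+ k) <= k%:R * d.
  elim: k => [|k ih]; first by rewrite expr0 subrr cabs0 mul0r.
  have -> : 1 - z ^+ k.+1 = (1 - z ^+ k) + z ^+ k * (1 - z) by rewrite exprS; ring.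
  rewrite (le_trans (cabsD _ _))// cabsM cabsX z1 expr1n mul1r -natr1 mulrDl mul1r.
  by rewrite lerD2r.
(* Summing [powd] over k < n gives at most [n ^+ 2 * d / 2], which is at most [n / 2] because
   [n * d <= 1]. *)
have : cabs (n%:R - \sum_(k < n) z ^+ k) <= n%:R ^+ 2 * d / 2.
  elim: n {nz} => [|n ih].
    by rewrite big_ord0 subr0 cabs0 expr0n /= !mul0r.
  have -> : n.+1%:R - \sum_(k < n.+1) z ^+ k =
      (n%:R - \sum_(k < n) z ^+ k) + (1 - z ^+ n).
    by rewrite big_ord_recr /= -natr1; ring.
  rewrite (le_trans (cabsD _ _))// (le_trans (lerD ih (powd n)))//.
  rewrite -(natr1 n) (_ : (n%:R + 1) ^+ 2 * d / 2 =
    n%:R ^+ 2 * d / 2 + n%:R * d + d / 2); last by field.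
  by rewrite lerDl divr_ge0// cabs_ge0.
have := cabs_le_dist n%:R (\sum_(k < n) z ^+ k).
rewrite -(rmorph_nat (real_complex R)) cabs_real ger0_norm//.
have : (0 : R) <= n%:R by []. nra.
Qed.

Lemma fejer_small L z (r : R) : cabs z = 1 -> 0 < r -> r <= cabs (1 - z) ->
  cabs (fejer L z) <= 4 / (L.+1%:R * r ^+ 2).
Proof.
move=> z1 r0 rz; rewrite fejerE// cabs_real ger0_norm; last first.
  by rewrite divr_ge0// exprn_ge0// cabs_ge0.
have := cabs_geom L.+1 z1; set D := cabs (\sum_(_ < _) _) => Dz.
have D0 : 0 <= D by exact: cabs_ge0.
have Dr : D * r <= 2 by rewrite (le_trans _ Dz)// mulrC ler_wpM2r.
have -> : 4 / (L.+1%:R * r ^+ 2) = 4 / r ^+ 2 / L.+1%:R.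
  by rewrite invfM mulrA mulrAC.
rewrite ler_pM2r ?invr_gt0 ?ltr0n// ler_pdivlMr ?exprn_gt0// -exprMn.
rewrite (_ : 4 = 2 ^+ 2); last by ring.
have Dr0 : 0 <= D * r by rewrite mulr_ge0// ltW.
by rewrite ler_sqr ?nnegrE.
Qed.

Lemma fejer_large L z : cabs z = 1 -> L.+1%:R * cabs (1 - z) <= 1 ->
  L.+1%:R / 4 <= complex.Re (fejer L z).
Proof.
move=> z1 Lz; rewrite fejerE//.
have := cabs_geom_near1 z1 Lz; set D := cabs (\sum_(_ < _) _) => Dz.
rewrite [leRHS](_ : _ = D ^+ 2 / L.+1%:R)//.
have L0 : (0 : R) < L.+1%:R by rewrite ltr0n.
by rewrite ler_pdivlMr//; nra.
Qed.

(** Abel summation: the weights decrease from 1, so multiplication by [1 - z] leaves a bounded total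
    variation, whatever [K] and [L] are. *)
Lemma fejer_partial_bound L K z (r : R) : cabs z = 1 -> 0 < r ->
  r <= cabs (1 - z) -> cabs (fejer_partial L K z) <= 2 / r.
Proof.
move=> z1 r0 rz.
set w := fejer_weight L.
(* The left side has modulus 1 for [K = 0], and each step adds at most [w K - w K.+1]. *)
have key : cabs ((1 - z) * fejer_partial L K z + (w K)%:C * z ^+ K.+1) <= 2 - w K.
  elim: K => [|K ih].
    rewrite /fejer_partial big_geq// mulr0 add0r cabsM cabs_real expr1 z1 mulr1.
    by rewrite /w fejer_weight0 normr1; lra.
  have -> : (1 - z) * fejer_partial L K.+1 z + (w K.+1)%:C * z ^+ K.+2 =
     ((1 - z) * fejer_partial L K z + (w K)%:C * z ^+ K.+1)
      + (w K.+1 - w K)%:C * z ^+ K.+1.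
    rewrite /fejer_partial big_nat_recr//= rmorphB /= [z ^+ K.+2]exprS -/w; ring.
  rewrite (le_trans (cabsD _ _))// cabsM cabs_real cabsX z1 expr1n mulr1.
  have := fejer_weightS L K; rewrite -/w => wS.
  by rewrite ler0_norm ?subr_le0//; move: ih; lra.
have : cabs ((1 - z) * fejer_partial L K z) <= 2.
  rewrite (le_trans (cabs_le_dist _ (- ((w K)%:C * z ^+ K.+1))))//.
  rewrite opprK cabsN cabsM cabs_real cabsX z1 expr1n mulr1.
  have /andP[w0 _] := fejer_weight_bound L K.
  by rewrite ger0_norm//; move: key; rewrite -/w; lra.
rewrite cabsM ler_pdivlMr// => h.
by rewrite (le_trans _ h)// mulrC ler_wpM2r// cabs_ge0.
Qed.

End Fejer.

(** * Properties that hold off a set of small measure *)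

Section OffSmallSets.
Variable R : realType.
Implicit Types (P Q : R -> Prop) (e : R).

Definition outer_lebesgue : {outer_measure set R -> \bar R} :=
  ((lebesgue_stieltjes_measure.wlength (R := R) idfun)^*%mu :
    {outer_measure set (lebesgue_stieltjes_measure.ocitv_type R) -> \bar R}).

Definition period_itv : set R := `[0, pi *+ 2]%classic.

(* With the outer measure, exceptional sets need not be measurable. *)
Definition off e P : Prop :=
  (outer_lebesgue ([set t | ~ P t] `&` period_itv) <= e%:E)%E.

Lemma off_subset e P Q : (forall t, P t -> Q t) -> off e P -> off e Q.
Proof.
move=> PQ; apply: le_trans; apply: le_outer_measure => t [/= nQ It].
by split => //= /PQ.
Qed.

Lemma off_le e e' P : e <= e' -> off e P -> off e' P.
Proof. by move=> ee' /le_trans; apply; rewrite lee_fin. Qed.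

Lemma offT P : (forall t, P t) -> off 0 P.
Proof.
move=> hP; rewrite /off (_ : _ `&` _ = set0) ?outer_measure0//.
by apply/seteqP; split => // t [] /(_ (hP t)).
Qed.

Lemma off_and e e' P Q : off e P -> off e' Q -> off (e + e') (fun t => P t /\ Q t).
Proof.
move=> hP hQ; rewrite /off EFinD; apply: le_trans (leeD hP hQ).
apply: le_trans (outer_measureU2 _ _ _); apply: le_outer_measure => t [/= nPQ It].
have [Pt|nPt] := pselect (P t); last by left.
by right; split => //= Qt; apply: nPQ.
Qed.

Lemma off_forall e n (P : nat -> R -> Prop) :
  (forall i, (i < n)%N -> off e (P i)) ->
  off (n%:R * e) (fun t => forall i, (i < n)%N -> P i t).
Proof.
elim: n => [|n ih] hP; first by rewrite mul0r; apply: offT.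
rewrite -natr1 mulrDl mul1r.
apply: off_subset (off_and (ih _) (hP n _)) => //; last first.
  by move=> i im; apply: hP; rewrite ltnS ltnW.
move=> t [h1 h2] i; rewrite ltnS leq_eqVlt => /predU1P[->//|]; exact: h1.
Qed.

(** Countable subadditivity bounds the exceptions from stage [k0] on by the geometric tail
    [e / 2^k0], and [k0] is arbitrary. *)
Lemma off_borel_cantelli e (P : nat -> R -> Prop) : 0 <= e ->
  (forall k, off (e / (2 ^ k.+1)%:R) (P k)) ->
  outer_lebesgue ([set t | ~ exists k0, forall k, (k0 <= k)%N -> P k t] `&`
    period_itv) = 0%E.
Proof.
move=> e0 hP; apply/eqP; rewrite eq_le outer_measure_ge0 andbT.
have tail k0 : (outer_lebesgue
    ([set t | ~ exists k0, forall k, (k0 <= k)%N -> P k t] `&` period_itv) <=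
    (e / (2 ^ k0)%:R)%:E)%E.
  apply: (@le_trans _ _ (outer_lebesgue
      (\bigcup_k ([set t | ~ P (k0 + k)%N t] `&` period_itv)))).
    apply: le_outer_measure => t [/= nP It].
    have [allP|] := pselect (forall k, (k0 <= k)%N -> P k t).
      by exfalso; apply: nP; exists k0.
    move/existsNP => [k /not_implyP[k0k nPk]].
    by exists (k - k0)%N => //; split => //=; rewrite subnKC.
  apply: le_trans (outer_measure_sigma_subadditive _ _) _.
  have e0' : 0 <= e / (2 ^ k0)%:R by rewrite divr_ge0.
  apply: le_trans (epsilon_trick0 xpredT e0').
  apply: lee_nneseries => [k _ _|k _]; first exact: outer_measure_ge0.
  rewrite (_ : e / _ / _ = e / (2 ^ (k0 + k).+1)%:R); first exact: hP.
  by rewrite -addnS expnD natrM invfM mulrA.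
apply/lee_addgt0Pr => d d0; rewrite add0e.
have [n hn] : exists n : nat, e / d < n%:R.
  by exists (Num.trunc (e / d)).+1; rewrite truncnS_gt.
apply: le_trans (tail n) _; rewrite lee_fin ler_pdivrMr ?ltr0n ?expn_gt0//.
rewrite mulrC -ler_pdivrMr// ltW// (lt_le_trans hn)// ler_nat ltnW//.
exact: ltn_expl.
Qed.

End OffSmallSets.

(** * The set where an exponential is close to 1 *)

Section NearOne.
Local Open Scope complex_scope.
Variable R : realType.
Implicit Types (L m : nat).

Let phi L m (t : R) : R :=
  1 + \sum_(k < L) fejer_weight R L k.+1 * (cos ((k.+1 * m)%:R * t) *+ 2).

Let fejer_phi L m t : fejer L (expi (m%:R * t)) = (phi L m t)%:C.
Proof.
rewrite /fejer /fejer_partial -big_split /phi rmorphD rmorph1 rmorph_sum /=.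
rewrite big_add1 /= big_mkord; congr (_ + _); apply: eq_bigr => k _.
rewrite -mulrDr -[_ -i* _]/((conjc (expi (m%:R * t)))) expi_cos.
by rewrite [_ * (m%:R * t)]mulrA -natrM [RHS]rmorphM.
Qed.

(** An explicit antiderivative of [phi]: its sine terms vanish at both ends of the period, so [phi]
    has integral 2 pi. *)
Let Phi L m (t : R) : R :=
  t + \sum_(k < L) (fejer_weight R L k.+1 *+ 2 / (k.+1 * m)%:R) *
    sin ((k.+1 * m)%:R * t).

Let sin_multiple_period n : sin (n%:R * (pi *+ 2)) = 0 :> R.
Proof.
rewrite mulr_natl.
elim: n => [|n ih]; first by rewrite mulr0n sin0.
by rewrite mulrS addrC sinD ih mul0r sin2pi mulr0 addr0.
Qed.

Let derive_Phi L m t : (0 < m)%N -> is_derive t (1 : R) (Phi L m) (phi L m t).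
Proof.
move=> m0.
have -> : Phi L m = id + \sum_(k < L)
    (fun t => (fejer_weight R L k.+1 *+ 2 / (k.+1 * m)%:R) *
      sin ((k.+1 * m)%:R * t)).
  by apply/funext => u; rewrite /Phi fctE fct_sumE.
apply: is_deriveD; apply: is_derive_sum => k.
have km0 : (k.+1 * m)%:R != 0 :> R by rewrite pnatr_eq0 muln_eq0 negb_or -!lt0n.
pose c : R := (k.+1 * m)%:R.
have hd : is_derive t (1 : R) (fun t : R => sin (c * t)) (c * cos (c * t)).
  have h1 : is_derive t (1 : R) (fun t : R => c * t) c.
    have := is_deriveZ c (is_derive_id t (1 : R)).
    by rewrite -[_ *: _]/(c * 1) mulr1.
  have := is_derive1_comp (is_derive_sin (c * t)) h1.
  by rewrite mulrC.
have := is_deriveZ (fejer_weight R L k.+1 *+ 2 / c) hd.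
rewrite -[_ *: (_ * _)]/(_ * (_ * _)) -/c.
by rewrite mulrA mulfVK// mulrnAl mulrnAr mulrnAl.
Qed.

Let continuous_phi L m : continuous (phi L m).
Proof.
have cterm k : continuous (fun t : R =>
    fejer_weight R L k.+1 * (cos ((k.+1 * m)%:R * t) *+ 2)).
  move=> t; apply: cvgM; first exact: cvg_cst.
  apply: cvgMn.
  apply: (@continuous_comp _ _ _ (fun u : R => (k.+1 * m)%:R * u) cos).
    by apply: cvgM; [exact: cvg_cst|exact: cvg_id].
  exact: continuous_cos.
suff csum n : continuous (fun t : R => \sum_(k < n)
    fejer_weight R L k.+1 * (cos ((k.+1 * m)%:R * t) *+ 2)).
  by move=> t; apply: cvgD; [exact: cvg_cst|exact: csum].
elim: n => [|n ih].
  under eq_fun do rewrite big_ord0.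
  by move=> t; exact: cvg_cst.
under eq_fun do rewrite big_ord_recr /=.
by move=> t; apply: cvgD; [exact: ih|exact: cterm].
Qed.

Let integral_phi L m : (0 < m)%N ->
  (\int[@lebesgue_measure R]_(t in @period_itv R) (phi L m t)%:E = (pi *+ 2)%:E)%E.
Proof.
move=> m0.
have pi20 : (0 : R) < pi *+ 2 by rewrite pmulrn_lgt0 ?pi_gt0.
have cPhi : continuous (Phi L m).
  move=> t; apply: differentiable_continuous; apply/derivable1_diffP.
  by have [] := @derive_Phi L m t m0.
rewrite /period_itv (@continuous_FTC2 R (phi L m) (Phi L m))//.
- rewrite -EFinB; congr (_%:E); rewrite /Phi.
  rewrite big1 => [|k _]; last by rewrite sin_multiple_period mulr0.
  by rewrite big1 => [|k _]; rewrite ?mulr0 ?sin0 ?mulr0// !addr0 subr0.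
- exact/continuous_subspaceT/continuous_phi.
- split.
  + by move=> t _; have [] := @derive_Phi L m t m0.
  + exact/cvg_at_right_filter/cPhi.
  + exact/cvg_at_left_filter/cPhi.
- by move=> t _; rewrite derive1E; have [_] := @derive_Phi L m t m0.
Qed.

(** Chebyshev's inequality for Fejer's kernel: it is nonnegative with integral 2 pi, and at least
    (L+1)/4 where e^(imt) is within 1/(L+1) of 1. The bound does not depend on [m]. *)
Lemma off_near1 L m : (0 < m)%N ->
  off (8 * pi / L.+1%:R) (fun t : R => L.+1%:R^-1 <= cabs (1 - expi (m%:R * t))).
Proof.
move=> m0.
have L0 : (0 : R) < L.+1%:R by rewrite ltr0n.
have phi0 t : 0 <= phi L m t.
  have := fejerE L (cabs_expi (m%:R * t)); rewrite fejer_phi => -[->].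
  by rewrite divr_ge0// exprn_ge0// cabs_ge0.
have mphi : measurable_fun setT (phi L m).
  by apply: continuous_measurable_fun; exact: continuous_phi.
pose A : set R := [set t | L.+1%:R / 4 <= phi L m t] `&` @period_itv R.
have mA : measurable A.
  apply: measurableI; last exact: measurable_itv.
  rewrite -[X in measurable X]setTI.
  rewrite (_ : [set t | _] = phi L m @^-1` `[(L.+1%:R / 4), +oo[%classic); last first.
    by apply/seteqP; split => t /=; rewrite in_itv /= andbT.
  exact: mphi.
have BA : [set t : R | ~ L.+1%:R^-1 <= cabs (1 - expi (m%:R * t))] `&`
    @period_itv R `<=` A.
  move=> t [/= /negP]; rewrite -ltNge => h It; split => //=.
  have := @fejer_large R L _ (cabs_expi (m%:R * t)); rewrite fejer_phi; apply.
  by rewrite mulrC -ler_pdivlMr// mul1r ltW.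
apply: le_trans (le_outer_measure _ _ _ BA) _.
change (lebesgue_measure A <= (8 * pi / L.+1%:R)%:E)%E.
have h : ((L.+1%:R / 4)%:E * lebesgue_measure A <= (pi *+ 2)%:E)%E.
  rewrite -(@integral_cst _ _ R (@lebesgue_measure R) _ mA) -(@integral_phi L m m0).
  apply: (@le_trans _ _ (\int[lebesgue_measure]_(t in A) (phi L m t)%:E)%E).
    apply: ge0_le_integral => //.
    - by move=> t _; rewrite lee_fin divr_ge0.
    - by apply/measurable_EFinP; apply: measurable_funTS.
    - by move=> t []; rewrite lee_fin.
  apply: ge0_subset_integral => //.
  - exact: measurable_itv.
  - by apply/measurable_EFinP; apply: measurable_funTS.
  - by move=> t _; rewrite lee_fin.
  - exact: subIsetr.
move: h; rewrite -lee_pdivlMl ?divr_gt0// => /le_trans; apply.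
rewrite -EFinM lee_fin le_eqVlt; apply/orP; left; apply/eqP.
rewrite invf_div -mulr_natl; move: L0; move: (L.+1%:R : R) => l /gt_eqF l0.
by field; rewrite l0.
Qed.

End NearOne.

(** * The factors Q' and R *)

Section Spread.
Local Open Scope complex_scope.
Variable R : realType.
Implicit Types (z : R[i]).

Lemma expr_small (x e : R) : 0 <= x -> x < 1 -> 0 < e -> exists n : nat, x ^+ n <= e.
Proof.
move=> x0 x1 e0.
have : (fun n => x ^+ n) @ \oo --> (0 : R) by apply: cvg_expr; rewrite ger0_norm.
move/cvgrPdist_le => /(_ e e0) [n _ /(_ n (leqnn n))] /=.
by rewrite sub0r normrN ger0_norm ?exprn_ge0// => h; exists n.
Qed.

Lemma fejer_partialJ L K z : fejer_partial L K (conjc z) = (conjc (fejer_partial L K z)).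
Proof.
rewrite /fejer_partial rmorph_sum; apply: eq_bigr => k _.
by rewrite [RHS]rmorphM [X in _ = _ * X]rmorphXn /= oppr0.
Qed.

Lemma cabs_sqr z : cabs z ^+ 2 = complex.Re z ^+ 2 + complex.Im z ^+ 2.
Proof. by case: z => a b /=; rewrite sqr_sqrtr// addr_ge0// sqr_ge0. Qed.

(* If p is half of Fejer's kernel, then Re p <= -1/4 away from 1, so that
   |1 + 2 k p| < 1 there for small k > 0 while 1 + 2 k p is 1 at 0. *)
Lemma analytic_near_one (rho delta : R) : 0 < rho -> 0 < delta ->
  exists (G : nat) (gam : nat -> R[i]), gam 0%N = 0 /\
    forall z, cabs z = 1 -> rho <= cabs (1 - z) ->
      cabs (\sum_(j < G.+1) gam j * z ^+ j - 1) <= delta.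
Proof.
move=> rho0 delta0.
(* This [L] makes Fejer's kernel at most 1/2 away from 1, while [B] bounds its half p there. Since
   [kap ^+ 2 * B ^+ 2 = kap / 8], the square of |1 + 2 kap p| is at most 1 - kap + kap/2. *)
pose L := Num.trunc (8 / rho ^+ 2).
pose B := 2 / rho; pose kap := (8 * B ^+ 2)^-1.
have B0 : 0 < B by rewrite divr_gt0.
have kap0 : 0 < kap by rewrite invr_gt0 mulr_gt0// exprn_gt0.
pose q := Num.max 0 (1 - kap / 2).
have q0 : 0 <= q by rewrite le_max lexx.
have q1 : q < 1 by rewrite gt_max ltr01 /=; lra.
(* The target is [delta ^+ 2] because [q] bounds the square of the modulus. *)
have [n qn] := expr_small q0 q1 (exprn_gt0 2 delta0).
pose h : {poly R[i]} := \sum_(1 <= k < L.+1) (fejer_weight R L k)%:C *: 'X^k.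
pose P : {poly R[i]} := 1 - (1 + (kap *+ 2)%:C *: h) ^+ n.
have hE z : h.[z] = fejer_partial L L z.
  by rewrite horner_sum; apply: eq_bigr => k _; rewrite hornerZ hornerXn.
have PE z : P.[z] = 1 - (1 + (kap *+ 2)%:C * fejer_partial L L z) ^+ n.
  by rewrite !hornerE hE.
exists (size P), (fun j => P`_j); split.
  rewrite -horner_coef0 PE /fejer_partial big_nat_cond big1; last first.
    by move=> [|k]//= _; rewrite expr0n mulr0.
  by rewrite mulr0 addr0 expr1n subrr.
move=> z z1 rz.
rewrite -(horner_coef_wide _ (leqnSn _)) PE addrC addKr cabsN cabsX.
rewrite -(@ler_pXn2r _ 2)// ?nnegrE ?exprn_ge0 ?cabs_ge0//; last exact: ltW.
rewrite exprAC (le_trans _ qn)// lerXn2r ?nnegrE ?exprn_ge0 ?cabs_ge0//.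
rewrite le_max; apply/orP; right.
have pB := fejer_partial_bound L L z1 rho0 rz.
have F4 := fejer_small L z1 rho0 rz.
have Fle : complex.Re (fejer L z) <= 1 / 2.
  have L8 : 8 / rho ^+ 2 < L.+1%:R by rewrite truncnS_gt.
  have r20 : 0 < rho ^+ 2 by rewrite exprn_gt0.
  move: L8; rewrite ltr_pdivrMr// => L8.
  have : cabs (fejer L z) <= 1 / 2.
    apply: (le_trans F4); rewrite ler_pdivrMr; last by rewrite mulr_gt0.
    lra.
  rewrite fejerE// cabs_real; apply: le_trans; exact: ler_norm.
move: Fle pB; rewrite /fejer fejer_partialJ.
move: (fejer_partial L L z) => p; rewrite -/B => Fle pB.
have {}pB : cabs p ^+ 2 <= B ^+ 2 by rewrite ler_pXn2r ?nnegrE ?cabs_ge0// ltW.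
have kB : kap * (8 * B ^+ 2) = 1.
  by rewrite mulVf// lt0r_neq0// mulr_gt0// exprn_gt0.
move: pB; rewrite !cabs_sqr.
case: p Fle => x y /=; rewrite !(mul0r, subr0, add0r, addr0) => Fle pB.
have xx : x <= - 1 / 4 by lra.
have h1 : kap ^+ 2 * (x ^+ 2 + y ^+ 2) <= kap / 8.
  rewrite (_ : kap / 8 = kap ^+ 2 * B ^+ 2); first by rewrite ler_pM2l// exprn_gt0.
  have -> : kap ^+ 2 * B ^+ 2 = kap * (kap * (8 * B ^+ 2)) / 8 by clear; field.
  by rewrite kB mulr1.
have h2 : kap * x <= kap * (- 1 / 4) by rewrite ler_pM2l.
clear -h1 h2; move: (kap) h1 h2 => {}kap h1 h2.
rewrite (_ : _ + _ = 1 + 4 * (kap * x) + 4 * (kap ^+ 2 * (x ^+ 2 + y ^+ 2))).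
  lra.
by rewrite mulr2n; ring.
Qed.

Lemma sum_blocks (V : nmodType) m n (F : nat -> V) :
  \sum_(i < m * n) F i = \sum_(k < n) \sum_(r < m) F (m * k + r)%N.
Proof.
elim: n => [|n ih]; first by rewrite muln0 !big_ord0.
by rewrite big_ord_recr /= -ih mulnS addnC big_split_ord.
Qed.

(* The j-th frequency slot carries the shift [vs j]; the slots used for the
   s-th exponential are the multiples of [a s]. *)
Lemma spread_spectrum (S : nat) (sh : nat -> int) G (gam : nat -> R[i]) :
  gam 0%N = 0 ->
  exists (J : nat) (vs : nat -> int) (a : nat -> nat),
    (forall s, (0 < a s)%N) /\
    forall q : nat -> R[i], exists tau : nat -> R[i],
    [/\ tau 0%N = 0,
        \sum_(j < J.+1) cabs (tau j) <=
          (\sum_(s < S) cabs (q s)) * (\sum_(j < G.+1) cabs (gam j)) &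
        forall (b : nat) (t : R),
          \sum_(j < J.+1) tau j * expi (((b * j)%N%:Z + vs j)%:~R * t) =
          \sum_(s < S) q s * expi ((sh s)%:~R * t) *
            \sum_(j < G.+1) gam j * expi ((b * a s)%:R * t) ^+ j].
Proof.
move=> gam0; elim: S => [|S [J [vs [a [a0 ih]]]]].
  exists 0%N, (fun=> 0), (fun=> 1%N); split => // q; exists (fun=> 0); split => //.
    by rewrite big_ord0 mul0r big_ord_recl big_ord0 cabs0 addr0.
  by move=> b t; rewrite big_ord0 big1// => j _; rewrite mul0r.
(* The new exponential takes the positive multiples of [J.+1], all beyond the slots 0..J in use; the
   multiple 0 causes no clash since [gam 0 = 0]. *)
exists (J.+1 * G.+1).-1, (fun i => if (i < J.+1)%N then vs i else sh S),
  (fun s => if (s < S)%N then a s else J.+1); split=> [s|q]; first by case: ifP.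
have [tau [tau0 tauB tauE]] := ih q.
pose tau' i := if (i < J.+1)%N then tau i else
  if (J.+1 %| i)%N then q S * gam (i %/ J.+1)%N else 0.
(* Stated for any [F] that vanishes at coefficient 0, so as to serve both the coefficient sum and
   the exponential sum. *)
have blockE (V : nmodType) (F : R[i] -> nat -> V) : (forall i, F 0 i = 0) ->
    \sum_(i < (J.+1 * G.+1).-1.+1) F (tau' i) i = \sum_(j < J.+1) F (tau j) j +
      \sum_(j < G.+1) F (q S * gam j) (J.+1 * j)%N.
  move=> F0; rewrite prednK ?muln_gt0// (sum_blocks _ _ (fun i => F (tau' i) i)) big_ord_recl; congr (_ + _).
    by apply: eq_bigr => r _; rewrite /= muln0 add0n /tau' ltn_ord.
  rewrite [RHS]big_ord_recl /= gam0 mulr0 F0 add0r; apply: eq_bigr => k _.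
  rewrite big_ord_recl /= big1 => [|r _].
    by rewrite addr0 addn0 /tau' ltnNge leq_pmulr//= dvdn_mulr// mulKn.
  rewrite /tau' ltnNge (leq_trans _ (leq_addr _ _)) ?leq_pmulr//=.
  rewrite dvdn_addr ?dvdn_mulr// gtnNdvd ?F0//.
  exact: (ltn_ord (lift ord0 r)).
exists tau'; split.
- by [].
- rewrite (blockE _ (fun x _ => cabs x)) => [|_]; last exact: cabs0.
  rewrite [\sum_(s < S.+1) _]big_ord_recr /= mulrDl lerD// mulr_sumr.
  by apply: ler_sum => j _; rewrite cabsM.
- move=> b t.
  rewrite (blockE _ (fun x i => x * expi (((b * i)%N%:Z +
    (if (i < J.+1)%N then vs i else sh S))%:~R * t))); last by move=> i; rewrite mul0r.
  rewrite [RHS]big_ord_recr /=; congr (_ + _).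
    transitivity (\sum_(j < J.+1) tau j * expi (((b * j)%N%:Z + vs j)%:~R * t)).
      by apply: eq_bigr => j _; rewrite ltn_ord.
    by rewrite tauE; apply: eq_bigr => s _; rewrite ltn_ord.
  rewrite ltnn mulr_sumr; apply: eq_bigr => j _.
  have [->|j0] := posnP j; first by rewrite gam0 !(mulr0, mul0r).
  rewrite ltnNge leq_pmulr//= -expiMn -!mulrA; congr (_ * _).
  rewrite [RHS]mulrCA -expiD; congr (_ * expi _).
  by rewrite !intrD -!pmulrn !natrM; ring.
Qed.

Definition sym_sum (r : nat -> R) n z : R[i] :=
  \sum_(1 <= k < n.+1) (r k)%:C * (z ^+ k + (conjc z) ^+ k).

Lemma sym_sumS (r : nat -> R) n z : sym_sum r n.+1 z =
  sym_sum r n z + (r n.+1)%:C * (z ^+ n.+1 + (conjc z) ^+ n.+1).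
Proof. by rewrite /sym_sum big_nat_recr. Qed.

(* The copies occupy successive ranges of frequencies, so at most one of them is
   incomplete in a partial sum. *)
Lemma fejer_copies L (c : R) (M : nat) : 0 <= c ->
  exists (K : nat) (r : nat -> R) (m : nat -> nat),
  [/\ forall i, (0 < m i)%N, r 0%N = 0, forall k, `|r k| <= c,
      forall k, (K < k)%N -> r k = 0 &
      forall z rho, cabs z = 1 -> 0 < rho ->
        (forall i, (i < M)%N -> rho <= cabs (1 - z ^+ m i)) ->
        cabs (sym_sum r K z - (M%:R * c)%:C) <=
          M%:R * c * (4 / (L.+1%:R * rho ^+ 2)) /\
        forall n, cabs (sym_sum r n z) <=
          M%:R * c * (1 + 4 / (L.+1%:R * rho ^+ 2)) + c * (4 / rho)].
Proof.
move=> c0; elim: M => [|M [K [r [m [m0 r0 rc rK rz]]]]].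
  exists 0%N, (fun=> 0), (fun=> 1%N); split => // [k|z rho z1 rho0 _].
    by rewrite normr0.
  have s0 n : sym_sum (fun=> 0) n z = 0.
    by rewrite /sym_sum big1// => k _; rewrite mul0r.
  rewrite !mul0r s0 subr0 cabs0; split => // n.
  by rewrite s0 cabs0 add0r mulr_ge0// divr_ge0// ltW.
(* The new copy, [c] times 1 - (Fejer's kernel) without its constant term, lives on the multiples of
   [K.+1], above the frequencies of the earlier copies. *)
pose r' k := if (k <= K)%N then r k else
  if (K.+1 %| k)%N then - (c * fejer_weight R L (k %/ K.+1)) else 0.
exists (K.+1 * L.+1)%N, r', (fun i => if (i < M)%N then m i else K.+1); split.
- by move=> i; case: ifP.
- by [].
- move=> k; rewrite /r'; case: ifP => // _; case: ifP => _; last by rewrite normr0.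
  have /andP[w0 w1] := fejer_weight_bound R L (k %/ K.+1).
  by rewrite normrN ger0_norm ?mulr_ge0// ler_piMr.
- move=> k kK; rewrite /r' leqNgt (leq_trans _ kK) ?ltnS//=; last first.
    by rewrite (leq_trans (leqnSn K))// leq_pmulr.
  case: ifPn => // /dvdnP[j kE]; move: kK; rewrite kE mulnK// mulnC ltn_pmul2r//.
  by move=> Lj; rewrite fejer_weight_gt ?mulr0 ?oppr0// ltnW.
move=> z rho z1 rho0 rhoz.
have [rz1 rz2] : cabs (sym_sum r K z - (M%:R * c)%:C) <=
          M%:R * c * (4 / (L.+1%:R * rho ^+ 2)) /\
        forall n, cabs (sym_sum r n z) <=
          M%:R * c * (1 + 4 / (L.+1%:R * rho ^+ 2)) + c * (4 / rho).
  by apply: rz => // i iM; have := rhoz i (ltnW iM); rewrite iM.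
have rhoK : rho <= cabs (1 - z ^+ K.+1).
  by have := rhoz M (ltnSn M); rewrite ltnn.
have zK1 : cabs (z ^+ K.+1) = 1 by rewrite cabsX z1 expr1n.
pose T x := fejer_partial L x (z ^+ K.+1) + fejer_partial L x (conjc (z ^+ K.+1)).
have TS x : T x.+1 = T x + (fejer_weight R L x.+1)%:C *
    ((z ^+ K.+1) ^+ x.+1 + (conjc (z ^+ K.+1)) ^+ x.+1).
  by rewrite /T /fejer_partial ![\sum_(1 <= k < x.+2) _]big_nat_recr//=; ring.
have sE n : sym_sum r' n z = sym_sum r (minn n K) z - c%:C * T (n %/ K.+1)%N.
  elim: n => [|n ih].
    by rewrite min0n div0n /sym_sum /T /fejer_partial !big_geq// addr0 mulr0 subr0.
  rewrite sym_sumS ih divnS//.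
  have [nK|Kn] := leqP n.+1 K.
    rewrite (minn_idPl (ltnW nK)) sym_sumS /r' nK gtnNdvd//= add0n; ring.
  rewrite /r' leqNgt Kn /= (minn_idPr (_ : (K <= n)%N))//.
  case: ifPn => [Kn1|_]; last by rewrite add0n mul0r addr0.
  rewrite add1n TS.
  have -> : (n.+1 %/ K.+1)%N = (n %/ K.+1).+1 by rewrite divnS// Kn1.
  have e1 : (z ^+ K.+1) ^+ (n %/ K.+1).+1 = z ^+ n.+1.
    rewrite -exprM; congr (_ ^+ _); by rewrite mulnC -[RHS](divnK Kn1) divnS// Kn1.
  have e2 : (conjc (z ^+ K.+1)) ^+ (n %/ K.+1).+1 = (conjc z) ^+ n.+1.
    by rewrite -!rmorphXn /= e1.
  rewrite e1 e2 rmorphN rmorphM /=; ring.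
have TB x : cabs (T x) <= 4 / rho.
  rewrite (le_trans (cabsD _ _))// fejer_partialJ cabsJ.
  have := fejer_partial_bound L x zK1 rho0 rhoK.
  have -> : 4 / rho = 2 / rho + 2 / rho by rewrite -mulrDl; congr (_ / _); ring.
  exact: (fun h => lerD h h).
have c0' : cabs c%:C = c by rewrite cabs_real ger0_norm.
have FL := fejer_small L zK1 rho0 rhoK.
have TL x : (L <= x)%N -> - T x = 1 - fejer L (z ^+ K.+1).
  by move=> Lx; rewrite /T !(fejer_partial_gt _ Lx) /fejer; ring.
have e : M.+1%:R * c = M%:R * c + c by rewrite -natr1 mulrDl mul1r.
have full : cabs (sym_sum r K z - c%:C * T L - (M.+1%:R * c)%:C) <=
    M.+1%:R * c * (4 / (L.+1%:R * rho ^+ 2)).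
  rewrite e -mulrN TL// rmorphD mulrDl.
  rewrite (_ : _ - _ = (sym_sum r K z - (M%:R * c)%:C) -
    c%:C * fejer L (z ^+ K.+1)); last by ring.
  by rewrite (le_trans (cabsB _ _))// lerD// cabsM c0' ler_wpM2l.
split.
  rewrite sE mulKn// (minn_idPr _); last by rewrite (leq_trans (leqnSn K))// leq_pmulr.
  move: full; rewrite /T !(@fejer_partial_gt _ L L.+1)//.
move=> n; rewrite sE.
have d0 : 0 <= 4 / (L.+1%:R * rho ^+ 2).
  by rewrite divr_ge0// mulr_ge0// exprn_ge0// ltW.
have [nK|Kn] := leqP n K.
  rewrite divn_small// /T /fejer_partial !big_geq// addr0 mulr0 subr0.
  rewrite (le_trans (rz2 n))// lerD2r.
  by rewrite ler_wpM2r ?addr_ge0// e lerDl.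
(* The old copies are complete here. If the new one is cut, it alone costs [c * (4 / rho)];
   otherwise it is complete too and [full] applies. *)
have [_|Lx] := leqP (n %/ K.+1)%N L.
  rewrite (le_trans (cabsB _ _))// cabsM c0' lerD//; last by rewrite ler_wpM2l.
  have := cabs_le_dist (sym_sum r K z) (M%:R * c)%:C.
  rewrite cabs_real ger0_norm ?mulr_ge0// => h.
  rewrite (le_trans h)// [leRHS]mulrDr mulr1 lerD//.
    by rewrite e lerDl.
  by rewrite (le_trans rz1)// ler_wpM2r// e lerDl.
have e2 : T (n %/ K.+1)%N = T L by rewrite /T !(fejer_partial_gt _ (ltnW Lx)).
rewrite e2; have := cabs_le_dist (sym_sum r K z - c%:C * T L) (M.+1%:R * c)%:C.
rewrite cabs_real ger0_norm ?mulr_ge0// => h.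
rewrite (le_trans h)// [M.+1%:R * c * (1 + _)]mulrDr mulr1 -[leRHS]addrA.
rewrite lerD2l (le_trans full)// lerDl.
by rewrite mulr_ge0// divr_ge0// ltW.
Qed.

End Spread.

(** * Blocks of frequencies *)

Section Window.
Local Open Scope complex_scope.
Variable R : realType.
Implicit Types (z : R[i]).

Variables (J : nat) (vs : nat -> int).

(** One residue for each slot from -J to J, so that blocks centred at consecutive multiples do not
    overlap. *)
Definition window_block : nat := (J.+1 + J)%N.

(* The integers n = H k + j with 1 <= j <= J carry the shift of slot j, those of
   the form H k - j the opposite shift, because -n is then the slot j of -k. *)
Definition window_shift (n : nat) : int :=
  if (n %% window_block < J.+1)%N then vs (n %% window_block)%N
  else - vs (window_block - n %% window_block)%N.

Variables (tau : nat -> R[i]) (r : nat -> R).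

Definition window_pos (n : nat) : R[i] :=
  if (n %% window_block < J.+1)%N
  then (r (n %/ window_block)%N)%:C * tau (n %% window_block)%N else 0.

(** With H the block length, the second case is n = H (k+1) - j, where -n is slot j of -(k+1); the
    coefficients of R being even, the factor is [r] at k+1. *)
Definition window_neg (n : nat) : R[i] :=
  if (n %% window_block < J.+1)%N then 0
  else (r (n %/ window_block).+1)%:C * tau (window_block - n %% window_block)%N.

Definition sym_term (c d : R[i]) (l : int) (t : R) : R[i] :=
  c * expi (l%:~R * t) + d * expi ((- l)%:~R * t).

Lemma sym_term_bound c d l t : cabs (sym_term c d l t) <= cabs c + cabs d.
Proof. by rewrite (le_trans (cabsD _ _))// !cabsM !cabs_expi !mulr1. Qed.

Let block_gt0 : (0 < window_block)%N.
Proof. by []. Qed.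

(** The upper half of a block is read backwards; [B 0 = 0] lets both halves range over the same
    slots. *)
Let sum_block (V : nmodType) (F A B : nat -> V) :
  (forall n, (n < J.+1)%N -> F n = A n) ->
  (forall j, (0 < j < J.+1)%N -> F (window_block - j)%N = B j) -> B 0%N = 0 ->
  \sum_(n < window_block) F n = \sum_(j < J.+1) A j + \sum_(j < J.+1) B j.
Proof.
move=> FA FB B0; rewrite big_split_ord /=; congr (_ + _).
  by apply: eq_bigr => j _; rewrite FA.
rewrite [RHS]big_ord_recl B0 add0r -(big_mkord xpredT (fun i => F (J.+1 + i)%N)).
rewrite big_nat_rev /= add0n big_mkord; apply: eq_bigr => j _.
rewrite -FB; last exact: (ltn_ord (lift ord0 j)).
by congr F; rewrite /bump leq0n add1n /window_block; have := ltn_ord j; lia.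
Qed.

Definition window_sum (b m : nat) (t : R) : R[i] :=
  \sum_(n < m) sym_term (window_pos n) (window_neg n)
    ((b * n)%N%:Z + window_shift n) t.

(** This is the factor Q' of the construction. *)
Definition slow_factor (b : nat) (t : R) : R[i] :=
  \sum_(j < J.+1) tau j * expi (((b * j)%N%:Z + vs j)%:~R * t).

Hypothesis tau0 : tau 0%N = 0.
Hypothesis r0 : r 0%N = 0.

Let modlo k j : (j < J.+1)%N ->
  (((window_block * k + j) %% window_block)%N = j) *
  (((window_block * k + j) %/ window_block)%N = k).
Proof.
move=> jJ; have jH : (j < window_block)%N by rewrite ltn_addr.
by rewrite mulnC modnMDl divnMDl// modn_small// divn_small// addn0.
Qed.

Let modhi k j : (0 < j < J.+1)%N ->
  (((window_block * k + (window_block - j)) %% window_block)%N =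
     (window_block - j)%N) *
  (((window_block * k + (window_block - j)) %/ window_block)%N = k) *
  ((window_block - j < J.+1)%N = false).
Proof.
move=> /andP[j0 jJ]; have jH : (window_block - j < window_block)%N.
  by rewrite /window_block; lia.
rewrite mulnC modnMDl divnMDl// modn_small// divn_small// addn0; split => //.
by rewrite /window_block; lia.
Qed.

(** Over complete blocks the exponential of H k + j splits into one for k and one for the slot, so
    Q' factors out. Block k holds the positive term of index k but the negative one of index k+1. *)
Lemma window_sum_blocks b K t :
  let z := expi ((b * window_block)%:R * t) in
  window_sum b (window_block * K) t =
  slow_factor b t * \sum_(k < K) ((r k)%:C * z ^+ k + (r k.+1)%:C * (conjc z) ^+ k.+1).
Proof.
move=> z; have zJ : (conjc z) = expi (- ((b * window_block)%:R * t)) by rewrite expiN.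
rewrite /window_sum.
rewrite (sum_blocks _ _ (fun n => sym_term (window_pos n) (window_neg n)
  ((b * n)%N%:Z + window_shift n) t)) mulr_sumr; apply: eq_bigr => k _.
have -> : slow_factor b t * ((r k)%:C * z ^+ k + (r k.+1)%:C * (conjc z) ^+ k.+1) =
  \sum_(j < J.+1) ((r k)%:C * z ^+ k) *
     (tau j * expi (((b * j)%N%:Z + vs j)%:~R * t)) +
  \sum_(j < J.+1) ((r k.+1)%:C * (conjc z) ^+ k.+1) *
     (tau j * expi (((b * j)%N%:Z + vs j)%:~R * t)).
  by rewrite -!mulr_sumr -/(slow_factor b t); ring.
apply: (@sum_block _ (fun i => sym_term (window_pos (window_block * k + i)%N)
    (window_neg (window_block * k + i)%N)
    ((b * (window_block * k + i))%N%:Z + window_shift (window_block * k + i)%N) t)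
  (fun j => (r k)%:C * z ^+ k * (tau j * expi (((b * j)%N%:Z + vs j)%:~R * t)))
  (fun j => (r k.+1)%:C * (conjc z) ^+ k.+1 *
    (tau j * expi (((b * j)%N%:Z + vs j)%:~R * t)))).
- move=> j jJ; rewrite /sym_term /window_pos /window_neg /window_shift.
  rewrite !(modlo _ jJ) jJ mul0r addr0 -expiMn -!mulrA; congr (_ * _).
  rewrite mulrCA -expiD; congr (_ * expi _).
  by rewrite !intrD -!pmulrn !natrM natrD natrM; ring.
- move=> j jJ; have jH : (j <= window_block)%N.
    by move: jJ; rewrite /window_block; lia.
  set n := (window_block * k + (window_block - j))%N.
  have pE : window_pos n = 0 by rewrite /window_pos !(modhi k jJ).
  have nE : window_neg n = (r k.+1)%:C * tau j.
    by rewrite /window_neg !(modhi k jJ) subKn.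
  have sE : window_shift n = - vs j.
    by rewrite /window_shift !(modhi k jJ) subKn.
  rewrite /sym_term pE nE sE mul0r add0r /n {n pE nE sE} zJ -expiMn -!mulrA; congr (_ * _).
  rewrite mulrCA -expiD; congr (_ * expi _).
  rewrite opprD opprK !intrD rmorphN /= -!pmulrn.
  rewrite !natrM natrD natrM natrB// -natr1; ring.
- by rewrite tau0 mul0r mulr0.
Qed.

(** An incomplete block meets each slot at most twice, once from each half, with coefficients at
    most [a] times those of Q'. *)
Lemma window_sum_tail (a : R) b m t : (forall k, `|r k| <= a) ->
  cabs (window_sum b m t -
    window_sum b (window_block * (m %/ window_block)) t) <=
  2 * a * \sum_(j < J.+1) cabs (tau j).
Proof.
move=> ra; set H := window_block; set k := (m %/ H)%N.
pose w n := cabs (window_pos n) + cabs (window_neg n).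
have Hk : (H * k <= m)%N by rewrite mulnC leq_divM.
have mH : (m - H * k <= H)%N.
  by rewrite mulnC {1}(divn_eq m H) addKn ltnW// ltn_pmod.
have -> : window_sum b m t - window_sum b (H * k) t =
    \sum_(i < m - H * k) sym_term (window_pos (H * k + i)) (window_neg (H * k + i))
      ((b * (H * k + i))%N%:Z + window_shift (H * k + i)) t.
  rewrite -{1}(subnKC Hk) /window_sum big_split_ord /=.
  by rewrite addrAC subrr add0r.
apply: (le_trans (cabs_sum _ _ _)).
apply: (@le_trans _ _ (\sum_(i < m - H * k) w (H * k + i)%N)).
  by apply: ler_sum => i _; exact: sym_term_bound.
apply: (@le_trans _ _ (\sum_(i < H) w (H * k + i)%N)).
  rewrite -!(big_mkord xpredT (fun i => w (H * k + i)%N)).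
  rewrite (big_cat_nat (leq0n _) mH) /= lerDl sumr_ge0// => i _.
  by rewrite addr_ge0// cabs_ge0.
rewrite (@sum_block _ (fun i => w (H * k + i)%N)
  (fun j => `|r k| * cabs (tau j)) (fun j => `|r k.+1| * cabs (tau j))).
- rewrite -!mulr_sumr -mulrDl ler_wpM2r//.
    by apply: sumr_ge0 => j _; exact: cabs_ge0.
  by have := ra k; have := ra k.+1; lra.
- move=> j jJ; rewrite /w /window_pos /window_neg !(modlo _ jJ) jJ cabs0 addr0.
  by rewrite cabsM cabs_real.
- move=> j jJ; have jH : (j <= window_block)%N.
    by move: jJ; rewrite /window_block; lia.
  have pE : window_pos (H * k + (H - j))%N = 0.
    by rewrite /window_pos !(modhi k jJ).
  rewrite /w pE cabs0 add0r /window_neg !(modhi k jJ) subKn//.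
  by rewrite cabsM cabs_real.
- by rewrite tau0 cabs0 mulr0.
Qed.

Lemma sym_sum_blocks z K :
  \sum_(k < K.+1) ((r k)%:C * z ^+ k + (r k.+1)%:C * (conjc z) ^+ k.+1) =
  sym_sum r K z + (r K.+1)%:C * (conjc z) ^+ K.+1.
Proof.
elim: K => [|K ih].
  by rewrite big_ord_recl big_ord0 r0 mul0r addr0 /sym_sum big_geq// !add0r.
by rewrite big_ord_recr ih /= sym_sumS; ring.
Qed.

(** The [a] added to [B] pays for the unpaired negative term in [sym_sum_blocks], the last summand
    for the incomplete block. *)
Lemma window_sum_bound (a B : R) b m t :
  let z := expi ((b * window_block)%:R * t) in
  (forall k, `|r k| <= a) -> (forall n, cabs (sym_sum r n z) <= B) ->
  cabs (window_sum b m t) <= (B + a) * cabs (slow_factor b t) +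
    2 * a * \sum_(j < J.+1) cabs (tau j).
Proof.
move=> z ra sB.
have a0 : 0 <= a by exact: le_trans (ra 0%N).
apply: (le_trans (cabs_le_dist _ _)).
apply: lerD; last exact: window_sum_tail.
rewrite window_sum_blocks cabsM mulrC ler_wpM2r ?cabs_ge0// -/z.
case: (m %/ _)%N => [|K].
  by rewrite big_ord0 cabs0 addr_ge0// (le_trans _ (sB 0%N))// cabs_ge0.
rewrite sym_sum_blocks (le_trans (cabsD _ _))// lerD// cabsM cabs_real.
by rewrite cabsX cabsJ cabs_expi expr1n mulr1.
Qed.

Lemma window_sum_full b K t : r K.+1 = 0 ->
  window_sum b (window_block * K.+1) t =
  slow_factor b t * sym_sum r K (expi ((b * window_block)%:R * t)).
Proof. by move=> rK; rewrite window_sum_blocks sym_sum_blocks rK mul0r addr0. Qed.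

End Window.

Section WindowLemma.
Local Open Scope complex_scope.
Variable R : realType.

(** The frequencies run from -d to d; the coefficient [q s] belongs to [s - d]. *)
Definition trig_poly (d : nat) (q : nat -> R[i]) (t : R) : R[i] :=
  \sum_(s < d.*2.+1) q s * expi ((s%:Z - d%:Z)%:~R * t).

Lemma nat_above (x : R) : exists n : nat, x <= n.+1%:R.
Proof. by exists (Num.trunc x); rewrite ltW// truncnS_gt. Qed.

(* The number 1/e bounds the exceptional measure, 1/(p+1) the accuracy. *)
Definition good_window (e p D : nat) (sigma : nat -> int) : Prop :=
  forall (b : nat) (q : nat -> R[i]),
  (0 < b)%N -> \sum_(s < p.*2.+1) cabs (q s) <= p.+1%:R ->
  exists alpha beta : nat -> R[i],
  [/\ alpha 0%N = 0 /\ beta 0%N = 0,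
      forall n, (D < n)%N -> alpha n = 0 /\ beta n = 0 &
      off (8 * pi / e%:R + p.+1%:R^-1) (fun t => exists v : R[i],
        let V m := \sum_(n < m) sym_term (alpha n) (beta n)
                     ((b * n)%N%:Z + sigma n) t in
        [/\ cabs (v - trig_poly p q t) <= p.+1%:R^-1,
            cabs (V D.+1 - v) <= p.+1%:R^-1 * cabs v &
            forall m, cabs (V m) <= (3 + 4 * e%:R) * cabs v + p.+1%:R^-1])].

(** The order of choices matters: first the ingredients of Q', then [M] against their coefficient
    sum, then [rho] and [L] against [M]. All depend on [e] and [p] only, so the shifts are fixed
    before [b] and [q]. *)
Lemma window_exists (e p : nat) : (0 < e)%N ->
  exists (D : nat) (sigma : nat -> int), good_window e p D sigma.
Proof.
move=> e0; set P : R := p.+1%:R; set S := p.*2.+1.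
have P0 : 0 < P by rewrite ltr0n.
(* The union of the [S] exceptional sets of Q' then has measure at most 1/P. *)
have [Lg LgP] := nat_above (S%:R * (8 * pi) * P).
have rg0 : (0 : R) < Lg.+1%:R^-1 by rewrite invr_gt0 ltr0n.
(* Accuracy 1/P^2 for each g_s, times a coefficient sum of at most P, gives 1/P. *)
have dg0 : 0 < (P ^+ 2)^-1 by rewrite invr_gt0 exprn_gt0.
have [G [gam [gam0 gamE]]] := analytic_near_one rg0 dg0.
have [J [vs [a [a0 spread]]]] :=
  spread_spectrum S (fun s => s%:Z - p%:Z) G gam0.
pose Gam : R := \sum_(j < G.+1) cabs (gam j).
(* This makes the contribution of an incomplete block, 2 P Gam / M, at most 1/P. *)
have [M' MP] := nat_above (2 * P ^+ 2 * Gam); set M := M'.+1.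
have M0 : (0 : R) < M%:R by rewrite ltr0n.
have c0 : (0 : R) <= M%:R^-1 by rewrite invr_ge0 ltW.
have c1 : (M%:R^-1 : R) <= 1 by rewrite invf_le1// ler1n.
(* The [M] exceptional sets then have total measure at most 8 pi / e, and a cut copy of weight 1/M
   costs (1/M)(4/rho) = 4e. *)
pose rho : R := (M * e)%:R^-1.
have rho0 : 0 < rho by rewrite invr_gt0 ltr0n muln_gt0.
have [L LP] := nat_above (4 / rho ^+ 2 * P).
have [K [r [m [m0 r0 rc rK rz]]]] := fejer_copies L M c0.
have Mc : M%:R * M%:R^-1 = 1 :> R by rewrite divff// lt0r_neq0.
have fL : 4 / (L.+1%:R * rho ^+ 2) <= P^-1.
  have r20 : 0 < rho ^+ 2 by rewrite exprn_gt0.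
  move: LP; rewrite -ler_pdivlMr// ler_pdivrMr// => LP.
  by rewrite ler_pdivrMr ?mulr_gt0// mulrA [P^-1 * _]mulrC.
set H := window_block J.
exists (H * K.+1).-1, (window_shift J vs) => b q b0 qP.
have [tau [tau0 tauB tauE]] := spread q.
have HK : ((H * K.+1).-1.+1 = H * K.+1)%N by rewrite prednK.
exists (window_pos J tau r), (window_neg J tau r); split.
- by rewrite /window_pos /window_neg mod0n div0n /= r0 mul0r.
- move=> n; rewrite HK => nHK.
  have Kn : (K < n %/ H)%N by rewrite leq_divRL// mulnC.
  by rewrite /window_pos /window_neg !rK ?mul0r ?if_same// ltnW.
have tauPG : \sum_(j < J.+1) cabs (tau j) <= P * Gam.
  rewrite (le_trans tauB)// ler_wpM2r//.
  by apply: sumr_ge0 => j _; exact: cabs_ge0.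
have off1 : off P^-1 (fun t : R => forall s, (s < S)%N ->
    Lg.+1%:R^-1 <= cabs (1 - expi ((b * a s)%:R * t))).
  apply: off_le; last first.
    by apply: off_forall => s _; apply: off_near1; rewrite muln_gt0 b0 a0.
  rewrite mulrA ler_pdivrMr ?ltr0n// [leRHS]mulrC ler_pdivlMr//.
have off2 : off (8 * pi / e%:R) (fun t : R => forall i, (i < M)%N ->
    rho <= cabs (1 - expi ((m i * (b * H))%:R * t))).
  have Me : (M * e).-1.+1 = (M * e)%N by rewrite prednK// muln_gt0.
  have := @off_forall R (8 * pi / (M * e)%:R) M (fun i t =>
    rho <= cabs (1 - expi ((m i * (b * H))%:R * t))).
  rewrite (_ : M%:R * _ = 8 * pi / e%:R); last first.
    by rewrite natrM; field; rewrite !pnatr_eq0 -!lt0n e0.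
  apply=> i _; rewrite /rho -Me; apply: off_near1.
  by rewrite !muln_gt0 m0 b0.
rewrite addrC; apply: off_subset (off_and off1 off2) => t [h1 h2].
exists (slow_factor J vs tau b t).
set z := expi ((b * H)%:R * t).
have z1 : cabs z = 1 by exact: cabs_expi.
have {rz}[] := rz z rho z1 rho0.
  by move=> i iM; rewrite -expiMn mulrA -natrM; exact: h2.
rewrite Mc => rz1 rz2.
have {}rz1 : cabs (sym_sum r K z - 1) <= P^-1.
  by rewrite (le_trans _ fL)// -[leRHS]mul1r.
have P1 : P^-1 <= 1 by rewrite invf_le1// ler1n.
have {}rz2 n : cabs (sym_sum r n z) <= 2 + 4 * e%:R.
  rewrite (le_trans (rz2 n))// mul1r lerD//.
    by rewrite (le_trans (lerD (lexx 1) (le_trans fL P1)))//; lra.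
  rewrite /rho invrK natrM.
  have -> : M%:R^-1 * (4 * (M%:R * e%:R)) = M%:R * M%:R^-1 * (4 * e%:R) :> R by ring.
  by rewrite Mc mul1r.
split.
- rewrite /slow_factor tauE /trig_poly -sumrB.
  apply: (le_trans (cabs_sum _ _ _)).
  apply: (@le_trans _ _ (\sum_(s < S) cabs (q s) * (P ^+ 2)^-1)).
    apply: ler_sum => s _; rewrite -[X in _ - X]mulr1 -mulrBr !cabsM.
    rewrite cabs_expi mulr1 ler_wpM2l ?cabs_ge0//.
    by apply: gamE; [exact: cabs_expi|exact: h1].
  rewrite -mulr_suml (le_trans (ler_wpM2r _ qP)) ?(ltW dg0)//.
  by rewrite exprS expr1 invfM mulrA divff ?mul1r// lt0r_neq0.
- rewrite HK -/(window_sum J vs tau r b _ t) window_sum_full//; last exact: rK.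
  by rewrite -[X in _ - X]mulr1 -mulrBr cabsM mulrC ler_wpM2r// cabs_ge0.
- move=> n; rewrite -/(window_sum J vs tau r b _ t).
  apply: (le_trans (window_sum_bound vs tau0 r0 n rc rz2)).
  apply: lerD.
    (* The constant 3 + 4e is the bound 2 + 4e of [rz2] plus 1/M <= 1. *)
    by rewrite ler_wpM2r ?cabs_ge0//; lra.
  apply: (@le_trans _ _ (2 * M%:R^-1 * (P * Gam))).
    by rewrite ler_wpM2l// mulr_ge0.
  rewrite mulrAC ler_pdivrMr// [leRHS]mulrC ler_pdivlMr//.
  by rewrite (le_trans _ MP)// le_eqVlt; apply/orP; left; apply/eqP; ring.
Qed.

End WindowLemma.

(** * The lacunary sequence *)

Section Lacunary.
Variable R : realType.

Definition has_window (lam : nat -> int) (D : nat) (sigma : nat -> int) (N : nat) :=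
  exists2 b : nat, (0 < b)%N &
    forall i, (0 < i <= D)%N -> lam (N + i)%N = (b * i)%N%:Z + sigma i.

(** The positions after [N w] up to [N w + D w] form window [w], an arithmetic progression of slope
    [A (N w)] plus shifts; any other position is a window of its own. The jump into a new window is
    huge, and inside a window [eps] is already small. *)
Lemma lacunary_with_windows (eps : nat -> R) (D : nat -> nat)
    (sigma : nat -> nat -> int) : eps @ \oo --> (0 : R) ->
  exists lam : nat -> int,
  [/\ forall n, (0 < n)%N -> 0 < lam n,
      forall n, (0 < n)%N -> (1 + eps n) * (lam n)%:~R < (lam n.+1)%:~R &
      forall w, exists2 N, (w <= N)%N & has_window lam (D w) (sigma w) N].
Proof.
move=> eps0.
have [E epsE] : exists E : nat, forall n, eps n <= E%:R.
  have /cvg_seq_bounded /= : cvgn eps by apply/cvg_ex; exists 0.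
  move/pinfty_ex_gt0 => [M M0 hM]; exists (Num.trunc M).+1 => n.
  rewrite (le_trans (ler_norm _))// (le_trans (hM n I))//.
  by rewrite ltW// truncnS_gt.
have /choice[th thP] : forall w : nat, exists m : nat,
    forall n, (m <= n)%N -> eps n <= (4 * (D w).+1%:R)^-1.
  move=> w; have d0 : 0 < (4 * (D w).+1%:R)^-1 :> R by rewrite invr_gt0 mulr_gt0// ltr0n.
  move/cvgrPdist_le : eps0 => /(_ _ d0) [m _ hm]; exists m => n mn.
  by have := hm n mn; rewrite sub0r normrN; apply: le_trans; exact: ler_norm.
(* Each window starts beyond the previous one, and after its threshold [th w]. *)
pose N := fix N w := if w is w'.+1 then (N w' + D w' + 1 + th w)%N else th 0%N.
have NS w : N w.+1 = (N w + D w + 1 + th w.+1)%N by [].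
have thN w : (th w <= N w)%N by case: w => // w; rewrite NS leq_addl.
have Nmono w w' : (w < w')%N -> (N w + D w < N w')%N.
  elim: w' => // w' ih; rewrite ltnS leq_eqVlt => /predU1P[->|/ih]; rewrite NS; lia.
have wN w : (w <= N w)%N by elim: w => // w ih; rewrite NS; lia.
pose inw w n := (N w < n <= N w + D w)%N.
have inw_uniq w w' n : inw w n -> inw w' n -> w = w'.
  move=> h h'; case: (ltngtP w w') => // /Nmono; move: h h'; rewrite /inw; lia.
(* To each position belong the start of its window and its shift; a position outside all windows
   starts at [n.-1] with shift 0. *)
have /choice[pos posP] : forall n, exists x : nat * int,
    (exists2 w, inw w n & x = (N w, sigma w (n - N w)%N)) \/
    ((forall w, ~~ inw w n) /\ x = (n.-1, 0)).
  move=> n; have [[w wn]|nw] := pselect (exists w, inw w n).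
    by exists (N w, sigma w (n - N w)%N); left; exists w.
  exists (n.-1, 0); right; split => // w; apply/negP => wn.
  by apply: nw; exists w.
pose st n := (pos n).1; pose sg n := (pos n).2.
have stn n : (0 < n)%N -> (st n < n)%N.
  move=> n0; rewrite /st; case: (posP n) => [[w + ->]|[_ ->]] /=; rewrite /inw; lia.
pose zz w : nat := (\sum_(i < (D w).+1) `|sigma w i|)%N.
(* Since [w <= N w], the sum over [w <= m] covers any window that starts at [m]. *)
pose Z m : nat := (\sum_(w < m.+1) zz w)%N.
have sgZ n : (`|sg n| <= Z (st n))%N.
  rewrite /sg /st; case: (posP n) => [[w + ->]|[_ ->]] //=; rewrite /inw => wn.
  have nD : (n - N w < (D w).+1)%N by lia.
  apply: (@leq_trans (zz w)).
    by rewrite /zz (bigD1 (Ordinal nD))//= leq_addr.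
  have wNw : (w < (N w).+1)%N by rewrite ltnS.
  by rewrite /Z (bigD1 (Ordinal wNw))//= leq_addr.
(* The summand [4 * Z m + 1] lets the slope dominate the shifts; the product makes a window starting
   at [m] begin above [1 + E] times [lam m], even while [eps] is not small. *)
pose A := fix A m := if m is m'.+1 then
  (2 * (E + 1) * (m' + 2) * A m' + (4 * Z m'.+1 + 1))%N else (4 * Z 0 + 1)%N.
have AS m : A m.+1 = (2 * (E + 1) * (m + 2) * A m + (4 * Z m.+1 + 1))%N by [].
have AZ m : (4 * Z m + 1 <= A m)%N by case: m => // m; rewrite AS leq_addl.
have Amono m m' : (m <= m')%N -> (A m <= A m')%N.
  move=> mm'; rewrite -(subnKC mm'); elim: (m' - m)%N => [|k ih].
    by rewrite addn0.
  by rewrite addnS AS (leq_trans ih)//; nia.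
pose lam n : int := (A (st n) * (n - st n))%N%:Z + sg n.
have sgR n : `|(sg n)%:~R| <= (Z (st n))%:R :> R.
  by rewrite -intr_norm -[`|sg n|]abszE -pmulrn ler_nat.
have lamR n : (lam n)%:~R = (A (st n))%:R * (n - st n)%:R + (sg n)%:~R :> R.
  by rewrite /lam intrD -pmulrn natrM.
have AR m : 4 * (Z m)%:R + 1 <= (A m)%:R :> R.
  by rewrite -natrM natr1 ler_nat -addn1.
have Z0 m : 0 <= (Z m)%:R :> R by [].
have lam_gt0 n : (0 < n)%N -> 0 < (lam n)%:~R :> R.
  move=> n0; rewrite lamR.
  have i1 : 1 <= (n - st n)%:R :> R by rewrite ler1n subn_gt0 stn.
  have := AR (st n); have := sgR n; rewrite ler_norml => /andP[s1 _].
  by have := Z0 (st n); nra.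
exists lam; split.
- by move=> n n0; have := lam_gt0 n n0; rewrite ltr0z.
- move=> n n0.
  have l0 := lam_gt0 n n0.
  have [stE|[w [wn wn1]]] : st n.+1 = n \/ exists w, inw w n /\ inw w n.+1.
    rewrite /st; case: (posP n.+1) => [[w wn1 ->]|[_ ->]]; last by left.
    have [Nn|Nn] := eqVneq (N w) n; first by left.
    by right; exists w; split => //; move: wn1 Nn; rewrite /inw; lia.
  + have stn1 := stn n n0.
    have e1 : (lam n.+1)%:~R = (A n)%:R + (sg n.+1)%:~R :> R.
      by rewrite lamR stE subSn// subnn mulr1.
    have An : 2 * (1 + E%:R) * (n%:R + 1) * (A n.-1)%:R + (4 * (Z n)%:R + 1) =
        (A n)%:R :> R.
      case: n n0 {stE stn1 e1 l0} => // n _.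
      by rewrite AS /= -natr1 !natrD !natrM !natrD -(natr1 1); ring.
    have Ast : (A (st n))%:R <= (A n.-1)%:R :> R.
      by rewrite ler_nat Amono//; lia.
    have up : (lam n)%:~R <= (A n.-1)%:R * (n%:R + 1) :> R.
      rewrite lamR.
      have i1 : (n - st n)%:R <= n%:R :> R by rewrite ler_nat leq_subr.
      have i0 : 0 <= (n - st n)%:R :> R by [].
      have := AR (st n); have := sgR n; rewrite ler_norml => /andP[_ s1].
      have := Z0 (st n); move: Ast i1 i0 s1.
      move: (A (st n))%:R (A n.-1)%:R (n - st n)%:R n%:R (sg n)%:~R (Z (st n))%:R.
      move=> a a' i k s z h1 h2 h3 h4 h5 h6; nra.
    have lo : (A n)%:R - (Z n)%:R <= (lam n.+1)%:~R :> R.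
      rewrite e1 lerD2l; have := sgR n.+1; rewrite stE ler_norml => /andP[].
      by [].
    have eE : (1 + eps n) * (lam n)%:~R <= (1 + E%:R) * ((A n.-1)%:R * (n%:R + 1)).
      apply: (@le_trans _ _ ((1 + E%:R) * (lam n)%:~R)).
        by rewrite ler_wpM2r ?(ltW l0)// lerD2l.
      by rewrite ler_wpM2l.
    apply: (le_lt_trans eE); apply: (lt_le_trans _ lo).
    rewrite -An; have : 0 <= (1 + E%:R) * ((A n.-1)%:R * (n%:R + 1)) :> R.
      by rewrite !mulr_ge0// addr_ge0.
    have := Z0 n.
    rewrite (_ : 2 * (1 + E%:R) * (n%:R + 1) * (A n.-1)%:R =
      2 * ((1 + E%:R) * ((A n.-1)%:R * (n%:R + 1)))); last by ring.
    lra.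
  + have stw k : inw w k -> st k = N w.
      move=> wk; rewrite /st; case: (posP k) => [[w' w'k ->]|[/(_ w)]].
        by rewrite (inw_uniq _ _ _ wk w'k).
      by rewrite wk.
    have e1 := stw _ wn; have e2 := stw _ wn1.
    have := sgR n; have := sgR n.+1; rewrite !lamR e1 e2.
    have -> : (n.+1 - N w)%:R = (n - N w)%:R + 1 :> R.
      by rewrite natr1 subSn//; move: wn; rewrite /inw; lia.
    have i1 : (n - N w)%:R <= (D w).+1%:R :> R.
      by rewrite ler_nat; move: wn; rewrite /inw; lia.
    have i0 : 1 <= (n - N w)%:R :> R.
      by rewrite ler1n; move: wn; rewrite /inw; lia.
    have epsw : eps n <= (4 * (D w).+1%:R)^-1.
      by apply: thP; rewrite (leq_trans (thN w))//; move: wn; rewrite /inw; lia.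
    have := AR (N w); have := Z0 (N w); move: l0; rewrite lamR e1.
    have d0 : (0 : R) < (D w).+1%:R by rewrite ltr0n.
    move: i1 i0 epsw d0.
    move: ((n - N w)%:R : R) ((D w).+1%:R : R) ((Z (N w))%:R : R) ((A (N w))%:R : R).
    move: ((sg n)%:~R : R) ((sg n.+1)%:~R : R) (eps n).
    move=> s s' ep i d z a i1 i0 epsw d0 l0 z0 az.
    rewrite !ler_norml => /andP[s'1 s'2] /andP[s1 s2].
    (* Inside a window the increment is at least a - 2z with a >= 4z + 1, while [ep] times the
       current term is at most a/4 + z/4. *)
    have h : ep * (a * i + s) <= (a * i + s) / (4 * d).
      by rewrite mulrC ler_wpM2l// ltW.
    have h2 : (a * i + s) / (4 * d) <= a / 4 + z / 4.
      rewrite ler_pdivrMr ?mulr_gt0//.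
      have d1 : 1 <= d by exact: le_trans i1.
      have : a * i <= a * d by rewrite ler_wpM2l//; lra.
      have : z <= z * d by rewrite ler_peMr.
      by lra.
    lra.
- move=> w; exists (N w) => //; exists (A (N w)).
    by rewrite (leq_trans _ (AZ _))// addn1.
  move=> i iD.
  have wi : inw w (N w + i)%N by move: iD; rewrite /inw; lia.
  rewrite /lam /st /sg; case: (posP (N w + i)%N) => [[w' w'k ->]|[/(_ w)]].
    by rewrite -(inw_uniq _ _ _ wi w'k) /= addKn.
  by rewrite wi.
Qed.

End Lacunary.

(** * One approximation step along the lacunary sequence *)

Section ApproximationStep.
Local Open Scope complex_scope.
Variable R : realType.

(** Each increase of the degree adds a zero coefficient at both ends, as index [s] stands for
    frequency [s - d]. *)
Lemma trig_poly_widen d (q : nat -> R[i]) p : (d <= p)%N ->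
  exists2 q' : nat -> R[i], trig_poly p q' = trig_poly d q &
    \sum_(s < p.*2.+1) cabs (q' s) = \sum_(s < d.*2.+1) cabs (q s).
Proof.
move=> dp; rewrite -(subnK dp); elim: (p - d)%N => [|k [q' tE sE]]; first by exists q.
exists (fun s => if s is s'.+1 then
  if (s' < (k + d).*2.+1)%N then q' s' else 0 else 0).
  rewrite -tE; apply/funext => t; rewrite /trig_poly addSn doubleS.
  rewrite big_ord_recl mul0r add0r big_ord_recr /= /bump /= add1n ltnn mul0r addr0.
  apply: eq_bigr => s _; rewrite add1n ltn_ord; congr (_ * expi (_%:~R * _)).
  lia.
rewrite -sE addSn doubleS big_ord_recl cabs0 add0r big_ord_recr /=.
rewrite add0n ltnn cabs0 addr0.
by apply: eq_bigr => s _; rewrite add0n ltn_ord.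
Qed.

Lemma trig_poly_bound d (q : nat -> R[i]) t :
  cabs (trig_poly d q t) <= \sum_(s < d.*2.+1) cabs (q s).
Proof.
rewrite (le_trans (cabs_sum _ _ _))//.
by apply: ler_sum => s _; rewrite cabsM cabs_expi mulr1.
Qed.

Definition series_sum (lam : nat -> int) (al be : nat -> R[i]) (m : nat) (t : R) :=
  \sum_(n < m) sym_term (al n) (be n) (lam n) t.

Definition divergence_set (lam : nat -> int) (al be : nat -> R[i])
    (f : R -> R[i]) : set R :=
  [set t | ~ forall e : R, 0 < e -> exists m0, forall m,
    (m0 <= m)%N -> cabs (f t - series_sum lam al be m t) <= e].

Definition supported_on (al be : nat -> R[i]) (n0 n1 : nat) :=
  forall n, (n < n0)%N || (n1 <= n)%N -> al n = 0 /\ be n = 0.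

(** Padding with zeros makes Q fit a window with any large p, and such windows occur arbitrarily
    far; large p also turns 1/(p+1) into the accuracy [dl]. *)
Lemma approx_step (lam : nat -> int) (D : nat -> nat -> nat)
    (sigma : nat -> nat -> nat -> int) :
  (forall e p, (0 < e)%N -> good_window R e p (D e p) (sigma e p)) ->
  (forall e p n0, (0 < e)%N -> exists p' N, [/\ (p <= p')%N, (n0 <= N)%N &
    has_window lam (D e p') (sigma e p') N]) ->
  forall e d (q : nat -> R[i]) (dl : R) n0, (0 < e)%N -> 0 < dl ->
  exists n1 (al be : nat -> R[i]),
  [/\ (n0 < n1)%N, supported_on al be n0.+1 n1 &
    off (8 * pi / e%:R + dl) (fun t =>
      cabs (series_sum lam al be n1 t - trig_poly d q t) <= dl /\
      forall m, cabs (series_sum lam al be m t) <=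
        (3 + 4 * e%:R) * (cabs (trig_poly d q t) + dl) + dl)].
Proof.
move=> wE lamE e d q dl n0 e0 dl0.
pose B := \sum_(s < d.*2.+1) cabs (q s).
have B0 : 0 <= B by apply: sumr_ge0 => s _; exact: cabs_ge0.
(* The total error is at most (|v| + 1)/(p+1), where |v| <= B + 1. *)
have [p0 p0E] := nat_above ((B + 2) / dl).
have [p1 p1E] := nat_above B.
have [p [N [pp n0N lamw]]] := lamE e (maxn d (maxn p0 p1)) n0 e0.
move: pp; rewrite !geq_max => /and3P[dp pp0 pp1].
have P0 : (0 : R) < p.+1%:R by rewrite ltr0n.
have pB : B <= p.+1%:R by rewrite (le_trans p1E)// ler_nat.
have pdl : (B + 2) * p.+1%:R^-1 <= dl.
  rewrite ler_pdivrMr// mulrC -ler_pdivrMr//.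
  by rewrite (le_trans p0E)// ler_nat.
have [q' qE qB] := trig_poly_widen q dp.
have [b b0 lamb] := lamw.
have [al [be [[al0 be0] abD offV]]] := wE e p e0 b q' b0 (eq_ind_r (fun x => x <= _) pB qB).
pose al' n := if (N < n)%N then al (n - N)%N else 0.
pose be' n := if (N < n)%N then be (n - N)%N else 0.
have zterm l t : sym_term (0 : R[i]) 0 l t = 0 by rewrite /sym_term !mul0r addr0.
have sumE m t : series_sum lam al' be' m t =
    \sum_(n < m - N) sym_term (al n) (be n) ((b * n)%N%:Z + sigma e p n) t.
  elim: m => [|m ih]; first by rewrite sub0n /series_sum !big_ord0.
  rewrite /series_sum big_ord_recr /= -/(series_sum _ _ _ _ _) ih /al' /be'.
  case: (ltngtP m N) => [mN|Nm|->].
  - rewrite zterm addr0.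
    by have -> : (m.+1 - N = m - N)%N by lia.
  - rewrite subSn; last exact: ltnW.
    rewrite big_ord_recr /=; congr (_ + _).
    have [mD|Dm] := leqP (m - N) (D e p).
      by rewrite -lamb ?subnKC ?subn_gt0 ?Nm//; exact: ltnW.
    by have [-> ->] := abD _ Dm; rewrite !zterm.
  - by rewrite subSnn subnn zterm addr0 big_ord_recl !big_ord0 al0 be0 zterm addr0.
exists (N + (D e p).+1)%N, al', be'; split.
- by lia.
- move=> n nE; rewrite /al' /be'.
  have [Nn|//] := ltnP N n.
  by apply: abD; lia.
apply: off_subset (off_le _ offV); last first.
  rewrite lerD2l (le_trans _ pdl)// ler_peMl ?invr_ge0 ?(ltW P0)//.
  by move: B0; lra.
move=> t [v] /=; rewrite qE => -[v1 v2 v3].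
have i0 : 0 < (p.+1%:R^-1 : R) by rewrite invr_gt0.
have i1 : p.+1%:R^-1 <= 1 :> R by rewrite invf_le1// ler1n.
have i2 : p.+1%:R^-1 <= dl.
  by rewrite (le_trans _ pdl)// ler_peMl ?(ltW i0)//; move: B0; lra.
have vQ := cabs_le_dist v (trig_poly d q t).
have QB := trig_poly_bound d q t.
split.
- rewrite sumE addKn.
  rewrite (le_trans (cabs_sub_trans v _ _))//.
  rewrite (le_trans (lerD v2 v1))// (le_trans _ pdl)//.
  rewrite -/B in QB; rewrite -[X in _ * _ + X]mulr1 -mulrDr [leRHS]mulrC ler_wpM2l ?(ltW i0)//.
  have := le_trans vQ (lerD QB (le_trans v1 i1)); rewrite -/B; lra.
- move=> m; rewrite sumE (le_trans (v3 _))//.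
  apply: lerD => //; rewrite ler_wpM2l ?addr_ge0 ?mulr_ge0//.
  by rewrite (le_trans vQ)// lerD2l (le_trans v1).
Qed.

End ApproximationStep.

(** * Density of trigonometric polynomials in measure *)

Section Lusin.
Variable R : realType.

Lemma lebesgue_measurable_split (E : set R) :
  measurable (E : set (lebesgueR R)) ->
  exists A B : set R, [/\ measurable A, measurable B,
    lebesgue_measure B = 0%E & E `\` B = A `\` B].
Proof.
move=> mE; have : (completed_algebra_gen (@lebesgue_measure R)).-sigma.-measurable E.
  by rewrite completed_caratheodory_measurable.
rewrite g_sigma_completed_algebra_genE => -[A mA [M [B [mB B0 MB]]] <-].
exists A, B; split => //; rewrite setDUl (_ : M `\` B = set0) ?setU0//.
by apply/seteqP; split => // t [/MB].
Qed.

(** Each superlevel set at a rational level is Borel up to a null set; setting the function to 0 on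
    the countable union of these null sets makes it Borel. *)
Lemma borel_version (u : R -> R) :
  (forall c, measurable ([set t | c < u t] : set (lebesgueR R))) ->
  exists (g : measurableTypeR R -> R) (B : set R),
  [/\ measurable_fun setT g, measurable B, lebesgue_measure B = 0%E &
      forall t, ~ B t -> u t = g t].
Proof.
move=> mu.
pose q (n : nat) : R := ratr (odflt 0%Q (unpickle n)).
have /choice[A /choice[B AB]] : forall n, exists A B : set R,
    [/\ measurable A, measurable B, lebesgue_measure B = 0%E &
        [set t | q n < u t] `\` B = A `\` B].
  by move=> n; exact: lebesgue_measurable_split.
pose BB := \bigcup_n B n.
have mBB : measurable BB by apply: bigcupT_measurable => n; case: (AB n).
have BB0 : lebesgue_measure BB = 0%E.
  apply/negligibleP => //; apply: negligible_bigcup => n.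
  by have [_ mB B0 _] := AB n; apply/negligibleP.
pose g t : R := if pselect (BB t) then 0 else u t.
exists g, BB; split => //; last by move=> t nB; rewrite /g; case: pselect.
apply: (measurability _ (RGenOInfty.measurableE R)) => _ [_ [c ->] <-].
rewrite setTI (_ : _ @^-1` _ = (BB `&` [set _ | c < 0]) `|`
    ((\bigcup_n (A n `&` [set _ | c <= q n])) `\` BB)).
  apply: measurableU.
    have [c0|c0] := boolP (c < 0).
      rewrite (_ : [set _ | _] = setT) ?setIT//.
      by apply/seteqP; split.
    rewrite (_ : [set _ | _] = set0) ?setI0//.
    by apply/seteqP; split => // t /= h; rewrite h in c0.
  apply: measurableD => //; apply: bigcupT_measurable => n.
  have [mA _ _ _] := AB n.
  have [c0|c0] := boolP (c <= q n).
    rewrite (_ : [set _ | _] = setT) ?setIT//.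
    by apply/seteqP; split.
  rewrite (_ : [set _ | _] = set0) ?setI0//.
  by apply/seteqP; split => // t /= h; rewrite h in c0.
apply/seteqP; split => t /=.
  rewrite in_itv /= andbT /g; case: pselect => /= Bt cu; [by left|right; split => //].
  have [x] := rat_in_itvoo cu; rewrite in_itv /= => /andP[cx xu].
  exists (pickle x) => //; split; last by rewrite /q pickleK /= ltW.
  have nB : ~ B (pickle x) t by move=> ?; apply: Bt; exists (pickle x).
  have [_ _ _ e] := AB (pickle x).
  have : ([set t | q (pickle x) < u t] `\` B (pickle x)) t.
    by split => //=; rewrite /q pickleK.
  by rewrite e => -[].
rewrite in_itv /= andbT /g; case: pselect => /= Bt [[]//|[[n _ [An cq]] _]] //.
have nB : ~ B n t by move=> ?; apply: Bt; exists n.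
have [_ _ _ e] := AB n.
have : (A n `\` B n) t by [].
by rewrite -e => -[/= qu _]; exact: le_lt_trans cq qu.
Qed.

(** Lusin's theorem gives continuity on a large compact part of the period, and Tietze's theorem
    extends the restriction to a bounded continuous function. *)
Lemma lusin_period (u : R -> R) (dl : R) : 0 < dl ->
  (forall c, measurable ([set t | c < u t] : set (lebesgueR R))) ->
  exists (h : R -> R) (M : R),
  [/\ continuous h, forall t, `|h t| <= M & off dl (fun t => u t = h t)].
Proof.
move=> dl0 /borel_version[g [B [mg mB B0 ug]]].
have mI : measurable (@period_itv R) by exact: measurable_itv.
have fI : (lebesgue_measure (@period_itv R) < +oo)%E.
  by rewrite /period_itv lebesgue_measure_itv/= ; case: ifP => _; rewrite ?ltry// -EFinB ltry.
have [K [cK KI KE ctsK]] := @measurable_almost_continuous R _ mI fI g dl dl0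
  (measurable_funTS mg).
have [M [M0 KM]] : exists M : R, 0 < M /\ forall t, K t -> `|g t| <= M.
  have /compact_bounded[M [_ hM]] := continuous_compact ctsK cK.
  exists (`|M| + 1); split; first by rewrite ltr_pwDr.
  move=> t Kt; apply: (hM (`|M| + 1)); last by exists t.
  by rewrite (le_lt_trans (ler_norm _))// ltrDl.
have [] := @continuous_bounded_extension R R _ K _ g M M0 ctsK.
- exact: pseudometric_normal.
- by apply: compact_closed => //; exact: Rhausdorff.
- by [].
move=> h [gh ch hM]; exists h, M; split => //.
apply: (@le_trans _ _ (outer_lebesgue R ((@period_itv R `\` K) `|` B))).
  apply: le_outer_measure => t [/= nu It].
  have [Bt|nB] := pselect (B t); first by right.
  left; split => // Kt; apply: nu; rewrite ug//.
  by rewrite gh// inE.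
apply: le_trans (outer_measureU2 _ _ _) _.
have -> : outer_lebesgue R B = 0%E by exact: B0.
by rewrite adde0; exact: ltW.
Qed.

(** Heine's theorem from compactness of the segment; only [x] is confined to it. *)
Lemma heine_segment (h : R -> R) (a b e : R) : continuous h -> 0 < e ->
  exists2 k : R, 0 < k &
    forall x y, a <= x <= b -> `|x - y| < k -> `|h x - h y| <= e.
Proof.
move=> ch e0.
have e2 : 0 < e / 2 by rewrite divr_gt0.
have : near_covering `[a, b]%classic.
  by rewrite -compact_near_coveringP; exact: segment_compact.
move=> /(_ R (0:R)^'+ (fun k x => forall y, `|x - y| < k -> `|h x - h y| <= e)).
case.
- move=> x _; have /cvgrPdist_lt/(_ _ e2)[d /= d0 dh] := ch x.
  have d2 : 0 < d / 2 by rewrite divr_gt0.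
  exists (ball x (d / 2), [set k : R | 0 < k /\ k < d / 2]).
    split => /=; first exact: nbhsx_ballx.
    by exists (d / 2) => //= k /=; rewrite sub0r normrN => + k0; rewrite gtr0_norm.
  move=> [x' k] [/= xx' [k0 kd]] y xy.
  have hx' : `|h x - h x'| < e / 2.
    by apply: dh => /=; apply: (lt_le_trans xx'); lra.
  have hy : `|h x - h y| < e / 2.
    apply: dh => /=; rewrite (_ : x - y = (x - x') + (x' - y)); last by ring.
    rewrite (le_lt_trans (ler_normD _ _))//.
    have := xx'; rewrite /ball /= => h1; lra.
  rewrite (_ : h x' - h y = (h x - h y) - (h x - h x')); last by ring.
  rewrite (le_trans (ler_normB _ _))//; lra.
- move=> d /= d0 dP; exists (d / 2); first by rewrite divr_gt0.
  move=> x y xab xy; apply: (dP (d / 2)) => //=.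
  + by rewrite sub0r normrN gtr0_norm ?divr_gt0//; lra.
  + by rewrite divr_gt0.
Qed.

End Lusin.

Section Trigonometric.
Local Open Scope complex_scope.
Variable R : realType.
Implicit Types (g : R -> R[i]).

(** Lists with possible repetitions of frequencies make sums mere concatenations;
    [trigonometric_poly] returns to [trig_poly]. *)
Definition trigonometric g := exists s : seq (R[i] * int),
  forall t, g t = \sum_(x <- s) x.1 * expi (x.2%:~R * t).

Lemma trigonometric0 : trigonometric (fun=> 0).
Proof. by exists [::] => t; rewrite big_nil. Qed.

Lemma trigonometric_monomial c l : trigonometric (fun t => c * expi (l%:~R * t)).
Proof. by exists [:: (c, l)] => t; rewrite big_seq1. Qed.

Lemma trigonometricD g1 g2 : trigonometric g1 -> trigonometric g2 ->
  trigonometric (fun t => g1 t + g2 t).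
Proof. by move=> [s1 e1] [s2 e2]; exists (s1 ++ s2) => t; rewrite big_cat e1 e2. Qed.

Lemma trigonometricZ c g : trigonometric g -> trigonometric (fun t => c * g t).
Proof.
move=> [s e]; exists [seq (c * x.1, x.2) | x <- s] => t.
by rewrite big_map e mulr_sumr; apply: eq_bigr => x _; rewrite mulrA.
Qed.

Lemma trigonometric_sum n (G : nat -> R -> R[i]) :
  (forall i, trigonometric (G i)) -> trigonometric (fun t => \sum_(i < n) G i t).
Proof.
move=> GE; elim: n => [|n ih].
  by under eq_fun do rewrite big_ord0; exact: trigonometric0.
by under eq_fun do rewrite big_ord_recr /=; exact: trigonometricD.
Qed.

Lemma trigonometric_poly g : trigonometric g ->
  exists d q, forall t, trig_poly d q t = g t.
Proof.
move=> [s]; elim: s g => [|x s ih] g gE.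
  exists 0%N, (fun=> 0) => t; rewrite gE big_nil /trig_poly big1// => i _.
  by rewrite mul0r.
have [d [q qE]] := ih _ (fun t => erefl).
pose l := `|x.2|%N.
have [q1 q1E _] := trig_poly_widen q (leq_maxl d l).
have [q2 q2E] : exists q2 : nat -> R[i], forall t,
    trig_poly l q2 t = x.1 * expi (x.2%:~R * t).
  exists (fun s => if s%:Z == (x.2 + l%:Z)%R :> int then x.1 else 0) => t.
  have [n nE] : exists n : 'I_(l.*2.+1), n%:Z = (x.2 + l%:Z)%R :> int.
    have h : (`|(x.2 + l%:Z)%R| < l.*2.+1)%N by rewrite /l; lia.
    by exists (Ordinal h) => /=; rewrite /l; lia.
  rewrite /trig_poly (bigD1 n)//= nE eqxx big1 => [|i ni].
    by rewrite addrK addr0.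
  by rewrite -nE eqz_nat (inj_eq val_inj) (negbTE ni) mul0r.
have [q3 q3E _] := trig_poly_widen q2 (leq_maxr d l).
exists (maxn d l), (fun s => q1 s + q3 s) => t.
rewrite gE big_cons -q2E -qE -q1E -q3E addrC /trig_poly -big_split.
by apply: eq_bigr => i _; rewrite mulrDl.
Qed.

Lemma trigonometric_sym_sum (lam : nat -> int) (al be : nat -> R[i]) m :
  trigonometric (series_sum lam al be m).
Proof.
apply: (@trigonometric_sum m (fun n t => sym_term (al n) (be n) (lam n) t)) => n.
by apply: trigonometricD; exact: trigonometric_monomial.
Qed.

End Trigonometric.

(** * Fejer interpolation at equidistant nodes *)

Section FejerInterpolation.
Local Open Scope complex_scope.
Variable R : realType.

#[local] Arguments conjc : simpl never.

Lemma cabs_1Bexpi (y : R) : cabs (1 - expi y) = 2 * `|sin (y / 2)|.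
Proof.
have {1}-> : y = (y / 2) *+ 2 by rewrite -mulr_natr divfK.
move: (y / 2) => x.
have -> : 2 * `|sin x| = Num.sqrt ((2 * sin x) ^+ 2).
  by rewrite sqrtr_sqr normrM ger0_norm.
rewrite /=; congr Num.sqrt; rewrite cos_mulr2n sin_mulr2n.
have := cos2Dsin2 x; move: (cos x) (sin x) => c s cs.
have -> : (1 - (c ^+ 2 *+ 2 - 1)) ^+ 2 + (0 - (c * s) *+ 2) ^+ 2 =
    4 * (1 - c ^+ 2) ^+ 2 + 4 * (c ^+ 2) * s ^+ 2 by rewrite !mulr2n; ring.
have -> : c ^+ 2 = 1 - s ^+ 2 by rewrite -cs addrK.
ring.
Qed.

Lemma sin_ge_min (m y : R) : 0 < m -> m <= y -> y <= pi - m -> sin m <= sin y.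
Proof.
move=> m0 my ym.
have pi0 := @pi_gt0 R.
wlog yp : y my ym / y <= pi / 2.
  move=> wl; have [|yp] := leP y (pi / 2); first exact: wl.
  have -> : sin y = sin (pi - y) by rewrite sinB sinpi cospi; ring.
  by apply: wl; lra.
move: my; rewrite le_eqVlt => /predU1P[->//|my]; apply: ltW.
by rewrite ltr_sin// in_itv /=; apply/andP; split; lra.
Qed.

Definition node L (j : nat) : R := j%:R * (pi *+ 2 / L.+1%:R).

(* Sampling on L+1 equidistant nodes keeps Fejer's kernel a partition of unity, so
   that no convolution integral is needed. *)
Definition fejer_interp L (h : R -> R) (t : R) : R[i] :=
  \sum_(j < L.+1) (h (node L j) / L.+1%:R)%:C * fejer L (expi (t - node L j)).

(** For 0 < k < L+1 the k-th powers at the nodes form a geometric sum over a nontrivial root of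
    unity, which vanishes; only the constant terms remain. *)
Lemma sum_fejer_nodes L (t : R) :
  \sum_(j < L.+1) fejer L (expi (t - node L j)) = L.+1%:R.
Proof.
have L0 : (L.+1%:R : R) != 0 by rewrite pnatr_eq0.
have key (E w : R[i]) (k : nat) : w ^+ k != 1 -> w ^+ L.+1 = 1 ->
    \sum_(j < L.+1) (E * w ^+ j) ^+ k = 0.
  move=> wk wN; under eq_bigr do rewrite exprMn -exprM mulnC exprM.
  rewrite -mulr_sumr; apply/eqP; rewrite mulf_eq0; apply/orP; right.
  have : (w ^+ k - 1) * (\sum_(i < L.+1) (w ^+ k) ^+ i) == 0.
    by rewrite -subrX1 -exprM mulnC exprM wN expr1n subrr.
  by rewrite mulf_eq0 subr_eq0 (negbTE wk).
pose om : R[i] := expi (pi *+ 2 / L.+1%:R).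
have omN : om ^+ L.+1 = 1.
  by rewrite -expiMn mulrC divfK// /expi cos2pi sin2pi.
have omk k : (0 < k < L.+1)%N -> om ^+ k != 1.
  move=> /andP[k0 kL]; rewrite -expiMn; apply/eqP => e1.
  have := cabs_1Bexpi (k%:R * (pi *+ 2 / L.+1%:R)).
  rewrite e1 subrr cabs0 => /esym/eqP; rewrite mulf_eq0 pnatr_eq0 /= normr_eq0.
  apply/negP; rewrite gt_eqF// sin_gt0_pi//.
  have -> : k%:R * (pi *+ 2 / L.+1%:R) / 2 = pi * (k%:R / L.+1%:R) :> R.
    by rewrite mulr2n; field.
  rewrite mulr_gt0 ?pi_gt0 ?divr_gt0 ?ltr0n//= gtr_pMr ?pi_gt0//.
  by rewrite ltr_pdivrMr ?ltr0n// mul1r ltr_nat.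
have zE j : expi (t - node L j) = expi t * (conjc om) ^+ j.
  by rewrite expiD /node -mulrN expiMn expiN.
have zJ j : conjc (expi (t - node L j)) = conjc (expi t) * om ^+ j.
  by rewrite -!expiN opprB addrC expiD /node expiMn.
rewrite /fejer big_split /= sumr_const card_ord -[RHS]addr0; congr (_ + _).
rewrite big_split /= /fejer_partial [X in X + _]exchange_big [X in _ + X]exchange_big /=.
rewrite big_nat_cond big1 ?add0r => [|k /andP[kL _]]; last first.
  rewrite -mulr_sumr; under eq_bigr do rewrite zE.
  rewrite key ?mulr0//; last by rewrite -rmorphXn /= omN conjc1.
  apply: contra (omk k kL) => /eqP wk.
  have {}wk : conjc (om ^+ k) = 1 by rewrite rmorphXn.
  by rewrite -[om ^+ k]conjcK wk conjc1.
rewrite big_nat_cond big1 // => k /andP[kL _].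
rewrite -mulr_sumr; under eq_bigr do rewrite zJ.
by rewrite key ?mulr0// omk.
Qed.

Lemma trigonometric_fejer_interp L (h : R -> R) : trigonometric (fejer_interp L h).
Proof.
apply: (@trigonometric_sum R L.+1 (fun j t =>
  (h (node L j) / L.+1%:R)%:C * fejer L (expi (t - node L j)))) => j.
apply: trigonometricZ; apply: trigonometricD.
  have := @trigonometric_monomial R 1 0.
  by congr trigonometric; apply/funext => t; rewrite mul0r expi0 mulr1.
rewrite /fejer_partial; under eq_fun do rewrite !big_add1 !big_mkord /=.
apply: trigonometricD.
  apply: (@trigonometric_sum R L (fun k t =>
    (fejer_weight R L k.+1)%:C * expi (t - node L j) ^+ k.+1)) => k.
  apply: trigonometricZ.
  have := @trigonometric_monomial R (expi (k.+1%:R * - node L j)) k.+1%:Z.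
  congr trigonometric; apply/funext => t.
  by rewrite -expiMn -expiD -pmulrn -mulrDr addrC.
apply: (@trigonometric_sum R L (fun k t =>
  (fejer_weight R L k.+1)%:C * (conjc (expi (t - node L j))) ^+ k.+1)) => k.
apply: trigonometricZ.
have := @trigonometric_monomial R (expi (k.+1%:R * node L j)) (- k.+1%:Z).
congr trigonometric; apply/funext => t.
rewrite -expiN -expiMn -expiD rmorphN /= -pmulrn; congr expi; ring.
Qed.

(** The interpolant is a convex combination of nodal values: near nodes have values close to [h t],
    far nodes have small weights. As [h] need not be periodic, both ends of the period are given
    up. *)
Lemma fejer_interp_cvg (h : R -> R) (M dl : R) : continuous h ->
  (forall t, `|h t| <= M) -> 0 < dl ->
  exists L, off dl (fun t => cabs (fejer_interp L h t - (h t)%:C) <= dl).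
Proof.
move=> ch hM dl0.
have pi0 := @pi_gt0 R.
have dl2 : 0 < dl / 2 by rewrite divr_gt0.
have [k k0 kh] := heine_segment 0 (pi *+ 2) ch dl2.
pose kap := Num.min (dl / 2) (pi / 2).
have kap0 : 0 < kap by rewrite lt_min dl2 divr_gt0.
have kap1 : kap <= dl / 2 by rewrite ge_min lexx.
have kap2 : kap <= pi / 2 by rewrite ge_min lexx orbT.
(* With this [m], |1 - e^(iy)| < 2 sin m and |y| <= 2 pi - kap force |y| < k; [m <= kap / 2]
   excludes wrapping around the circle. *)
pose m := Num.min kap k / 2.
have m0 : 0 < m by rewrite divr_gt0// lt_min kap0.
have mk : m <= k / 2 by rewrite ler_pM2r// ge_min lexx orbT.
have mkap : m <= kap / 2 by rewrite ler_pM2r// ge_min lexx.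
pose rho := 2 * sin m.
have rho0 : 0 < rho by rewrite mulr_gt0// sin_gt0_pi// m0 /=; lra.
have M0 : 0 <= M by exact: le_trans (hM 0).
have [L LP] := nat_above (8 * M / rho ^+ 2 / (dl / 2)).
have L0 : (0 : R) < L.+1%:R by rewrite ltr0n.
exists L.
apply: (@off_subset _ _ (fun t : R => kap <= t <= pi *+ 2 - kap)); last first.
  pose I1 : set R := `[0, kap]%classic.
  pose I2 : set R := `[pi *+ 2 - kap, pi *+ 2]%classic.
  apply: (@le_trans _ _ (outer_lebesgue R (I1 `|` I2))).
    apply: le_outer_measure => t [/= nt]; rewrite /period_itv /= in_itv /=.
    move=> /andP[t0 t2].
    have [kt|tk] := leP kap t; last first.
      by left; rewrite /I1 /= in_itv /= t0 ltW.
    right; rewrite /I2 /= in_itv /= t2 andbT.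
    by rewrite leNgt; apply/negP => h1; apply: nt; rewrite kt ltW.
  apply: le_trans (outer_measureU2 _ _ _) _.
  have -> : outer_lebesgue R I1 = kap%:E.
    transitivity (lebesgue_measure I1) => //.
    by rewrite lebesgue_measure_itv /= lte_fin kap0 -EFinB subr0.
  have -> : outer_lebesgue R I2 = kap%:E.
    transitivity (lebesgue_measure I2) => //.
    by rewrite lebesgue_measure_itv /= lte_fin gtrBl kap0 -EFinB opprB addrC subrK.
  by rewrite -EFinD lee_fin; lra.
move=> t tk.
pose F j := cabs (fejer L (expi (t - node L j))).
have FE j : fejer L (expi (t - node L j)) = (F j)%:C.
  rewrite /F fejerE ?cabs_expi// cabs_real ger0_norm//.
  by rewrite divr_ge0// exprn_ge0// cabs_ge0.
have sumF : \sum_(j < L.+1) F j = L.+1%:R.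
  apply: (@complexI R); rewrite rmorph_sum rmorph_nat -(sum_fejer_nodes L t).
  by apply: eq_bigr => j _; rewrite FE.
have -> : fejer_interp L h t - (h t)%:C =
    \sum_(j < L.+1) ((h (node L j) - h t) / L.+1%:R * F j)%:C.
  have -> : (h t)%:C = \sum_(j < L.+1) (h t / L.+1%:R * F j)%:C.
    rewrite -rmorph_sum /= -mulr_sumr sumF divfK// lt0r_neq0//.
  rewrite /fejer_interp -sumrB; apply: eq_bigr => j _.
  by rewrite FE -rmorphM -rmorphB /= -mulrBl -mulrBl.
rewrite (le_trans (cabs_sum _ _ _))//.
(* Near nodes are charged to the first summand and far ones to the second; each adds up to
   [dl / 2]. *)
apply: (@le_trans _ _ (\sum_(j < L.+1)
   (dl / 2 / L.+1%:R * F j + dl / 2 / L.+1%:R))).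
  apply: ler_sum => j _; rewrite cabs_real.
  have F0 : 0 <= F j by exact: cabs_ge0.
  rewrite !normrM (ger0_norm F0) [`|_^-1|]ger0_norm ?invr_ge0 ?(ltW L0)//.
  have [jr|jr] := leP rho (cabs (1 - expi (t - node L j))).
    have FB : F j <= 4 / (L.+1%:R * rho ^+ 2).
      exact: fejer_small (cabs_expi _) rho0 jr.
    have hB : `|h (node L j) - h t| <= 2 * M.
      rewrite (le_trans (ler_normB _ _))//.
      by have := hM (node L j); have := hM t; lra.
    apply: (@le_trans _ _ (dl / 2 / L.+1%:R)); last first.
      by rewrite lerDr mulr_ge0// divr_ge0 ?ltW.
    rewrite mulrAC ler_pM2r ?invr_gt0//.
    apply: (@le_trans _ _ (2 * M * (4 / (L.+1%:R * rho ^+ 2)))).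
      by apply: ler_pM.
    move: LP; rewrite ler_pdivrMr// => LP.
    rewrite (_ : 2 * M * _ = 8 * M / rho ^+ 2 / L.+1%:R).
      by rewrite ler_pdivrMr// mulrC [leRHS]mulrC mulrC.
    by field; rewrite lt0r_neq0 ?lt0r_neq0.
  apply: (@le_trans _ _ (dl / 2 / L.+1%:R * F j)); last first.
    by rewrite lerDl divr_ge0 ?ltW.
  rewrite ler_wpM2r// ler_pM2r ?invr_gt0//.
  rewrite distrC; apply: kh; first by move: tk kap0 => /andP[]; lra.
  rewrite ltNge; apply/negP => kt.
  move: jr; apply/negP; rewrite -leNgt cabs_1Bexpi /rho ler_pM2l//.
  have nodeB : 0 <= node L j <= pi *+ 2.
    have pi2 : 0 <= pi *+ 2 :> R by rewrite mulrn_wge0// ltW.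
    rewrite /node mulrCA; apply/andP; split.
      by rewrite mulr_ge0// divr_ge0// ltW.
    by rewrite ler_piMr// ler_pdivrMr// mul1r ler_nat ltnW.
  have -> : `|sin ((t - node L j) / 2)| = sin (`|t - node L j| / 2).
    have [h0|h0] := leP 0 (t - node L j).
      rewrite (ger0_norm h0) ger0_norm//; apply: sin_ge0_pi; move: tk nodeB => /andP[? ?] /andP[? ?].
      apply/andP; split; first by rewrite divr_ge0.
      by rewrite ler_pdivrMr// mulr_natr; lra.
    rewrite -normrN -sinN -mulNr opprB ger0_norm.
      by rewrite ltr0_norm// opprB.
    apply: sin_ge0_pi; move: tk nodeB => /andP[? ?] /andP[? ?].
    apply/andP; split; first by rewrite divr_ge0//; lra.
    by rewrite ler_pdivrMr// mulr_natr; lra.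
  apply: sin_ge_min => //.
    by rewrite (le_trans mk)// ler_pM2r.
  have : `|t - node L j| <= pi *+ 2 - kap.
    by move: tk nodeB => /andP[? ?] /andP[? ?]; rewrite ler_norml; apply/andP; lra.
  by rewrite -mulr_natr; lra.
rewrite big_split /= -mulr_sumr sumF sumr_const card_ord divfK ?lt0r_neq0//.
rewrite -[X in _ + X]mulr_natr divfK ?lt0r_neq0//; lra.
Qed.

End FejerInterpolation.

Section Density.
Local Open Scope complex_scope.
Variable R : realType.

Lemma trigonometric_dense_real (u : R -> R) (dl : R) : 0 < dl ->
  (forall c, measurable ([set t | c < u t] : set (lebesgueR R))) ->
  exists2 g, trigonometric g & off dl (fun t => cabs (g t - (u t)%:C) <= dl).
Proof.
move=> dl0 mu; have d2 : 0 < dl / 2 by rewrite divr_gt0.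
have [h [M [ch hM uh]]] := lusin_period d2 mu.
have [L LP] := fejer_interp_cvg ch hM d2.
exists (fejer_interp L h); first exact: trigonometric_fejer_interp.
rewrite [dl in off dl]splitr; apply: off_subset (off_and uh LP) => t [-> h1].
by rewrite (le_trans h1)//; lra.
Qed.

(** A general functional treats the real and imaginary parts at once. *)
Lemma open_halfplane (l : {linear Rcomplex R -> R}) (c : R) :
  (forall z : R[i], `|l z|%:C <= `|z|) ->
  open ([set z | c < l z] : set (R[i]^o)).
Proof.
move=> lB; rewrite openE => z /= cz.
apply/nbhs_ballP; exists ((l z - c)%:C) => /=.
  by rewrite -[0]/(0%:C) ltcR subr_gt0.
move=> y; rewrite -ball_normE /= => h.
have := le_lt_trans (lB (z - y)) h.
rewrite ltcR raddfB => h1.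
have := le_lt_trans (ler_norm _) h1; lra.
Qed.

Lemma normc_ge_Im (z : R[i]) : `|complex.Im z|%:C <= `|z|.
Proof.
case: z => a b; rewrite cabsE lecR /= -sqrtr_sqr ler_wsqrtr//.
by rewrite lerDr sqr_ge0.
Qed.

(** In the iteration [s] is the partial sum built so far. Being trigonometric, it can be subtracted
    from an approximation of [f], found for real and imaginary parts separately. *)
Lemma trig_poly_dense (f s : R -> R[i]) (dl : R) : L0 f -> trigonometric s ->
  0 < dl -> exists d q, off dl (fun t => cabs (f t - s t - trig_poly d q t) <= dl).
Proof.
move=> [_ mf] ts dl0; have d2 : 0 < dl / 2 by rewrite divr_gt0.
have mU (U : set (R[i]^o)) : open U -> measurable (f @^-1` U : set (lebesgueR R)).
  move=> oU; rewrite -[X in measurable X]setTI; apply: mf => //.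
  exact: sub_sigma_algebra.
have [g1 tg1 o1] : exists2 g, trigonometric g &
    off (dl / 2) (fun t => cabs (g t - (complex.Re (f t))%:C) <= dl / 2).
  apply: trigonometric_dense_real => // c.
  apply: (mU [set z | c < complex.Re z]).
  exact: (@open_halfplane (@complex.Re R) c (@normc_ge_Re R)).
have [g2 tg2 o2] : exists2 g, trigonometric g &
    off (dl / 2) (fun t => cabs (g t - (complex.Im (f t))%:C) <= dl / 2).
  apply: trigonometric_dense_real => // c.
  apply: (mU [set z | c < complex.Im z]).
  exact: (@open_halfplane (@complex.Im R) c normc_ge_Im).
have [d [q qE]] := trigonometric_poly (trigonometricD tg1
  (trigonometricD (trigonometricZ 'i%C tg2) (trigonometricZ (-1) ts))).
exists d, q; rewrite [dl in off dl]splitr.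
apply: off_subset (off_and o1 o2) => t [h1 h2]; rewrite qE.
rewrite {1}[f t]complexE.
set a := (complex.Re _)%:C in h1 *; set b := (complex.Im _)%:C in h2 *.
rewrite (_ : _ - _ = - ((g1 t - a) + 'i%C * (g2 t - b))); last by ring.
have i1 : cabs ('i%C : R[i]) = 1 by rewrite /= expr0n /= expr1n add0r sqrtr1.
rewrite cabsN (le_trans (cabsD _ _))// cabsM i1 mul1r.
by rewrite [leRHS]splitr lerD.
Qed.

End Density.

(** * Almost everywhere convergence *)

Section Representation.
Local Open Scope complex_scope.
Variable R : realType.
Variable lam : nat -> int.

Hypothesis step : forall e d (q : nat -> R[i]) (dl : R) n0, (0 < e)%N -> 0 < dl ->
  exists n1 (al be : nat -> R[i]),
  [/\ (n0 < n1)%N, supported_on al be n0.+1 n1 &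
    off (8 * pi / e%:R + dl) (fun t =>
      cabs (series_sum lam al be n1 t - trig_poly d q t) <= dl /\
      forall m, cabs (series_sum lam al be m t) <=
        (3 + 4 * e%:R) * (cabs (trig_poly d q t) + dl) + dl)].

Lemma series_sumD (al be al' be' : nat -> R[i]) m t :
  series_sum lam (fun n => al n + al' n) (fun n => be n + be' n) m t =
  series_sum lam al be m t + series_sum lam al' be' m t.
Proof.
rewrite /series_sum -big_split; apply: eq_bigr => n _.
by rewrite /sym_term /=; ring.
Qed.

Lemma series_sum_tail (al be : nat -> R[i]) n m t : (n <= m)%N ->
  (forall i, (n <= i)%N -> al i = 0 /\ be i = 0) ->
  series_sum lam al be m t = series_sum lam al be n t.
Proof.
move=> nm ab0; rewrite -(subnKC nm) /series_sum big_split_ord /= [X in _ + X]big1.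
  by rewrite addr0.
move=> i _; have [-> ->] := ab0 _ (leq_addr i n).
by rewrite /sym_term !mul0r addr0.
Qed.

(** Stage k approximates the current remainder and adds terms beyond the old ones. Partial sums
    within stage k+1 are at most about 2^k times the remainder left by stage k, which is of order
    4^-k. *)
Lemma representation (f : R -> R[i]) : L0 f -> exists al be : nat -> R[i],
  [/\ al 0%N = 0, be 0%N = 0 &
  outer_lebesgue R (divergence_set lam al be f `&` @period_itv R) = 0%E].
Proof.
move=> Lf.
(* The rate 4^-k outweighs the factor [3 + 4 * 2 ^ k] that comes from [e = 2 ^ k]. *)
pose eta k : R := (4 ^ k)%:R^-1.
have eta0 k : 0 < eta k by rewrite invr_gt0 ltr0n expn_gt0.
pose good k n (al be : nat -> R[i]) n' (bal bbe : nat -> R[i]) t :=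
  cabs (f t - (series_sum lam al be n t + series_sum lam bal bbe n' t)) <=
    2 * eta k /\
  forall m, cabs (series_sum lam bal bbe m t) <=
    (3 + 4 * (2 ^ k)%:R) * (cabs (f t - series_sum lam al be n t) + 2 * eta k) +
    eta k.
have /choice[next nextP] : forall x : nat * (nat * (nat -> R[i]) * (nat -> R[i])),
    exists y : nat * (nat -> R[i]) * (nat -> R[i]),
    let: (k, (n, al, be)) := x in let: (n', bal, bbe) := y in
    [/\ (n < n')%N, supported_on bal bbe n.+1 n' &
      off ((16 * pi + 4) / (2 ^ k.+1)%:R) (good k n al be n' bal bbe)].
  move=> [k [[n al] be]].
  have [d [q dq]] := trig_poly_dense Lf (trigonometric_sym_sum lam al be n) (eta0 k).
  have e0 : (0 < 2 ^ k)%N by rewrite expn_gt0.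
  have [n' [bal [bbe [nn' sb ob]]]] := step d q n e0 (eta0 k).
  exists (n', bal, bbe); split => //.
  have k2 : (2 ^ k)%:R != 0 :> R by rewrite pnatr_eq0 -lt0n.
  have ek : eta k <= (2 ^ k)%:R^-1.
    rewrite lef_pV2 ?posrE ?ltr0n ?expn_gt0// ler_nat.
    by rewrite -[4%N]/(2 * 2)%N expnMn leq_pmulr// expn_gt0.
  apply: (@off_le _ (eta k + (8 * pi / (2 ^ k)%:R + eta k))).
    rewrite expnS natrM invfM.
    rewrite (_ : (16 * pi + 4) * _ = 8 * pi / (2 ^ k)%:R + 2 * (2 ^ k)%:R^-1).
      by lra.
    by field.
  apply: off_subset (off_and dq ob) => t [h1 [h2 h3]].
  set S := series_sum lam al be n t in h1 *; set Q := trig_poly d q t in h1 h2 h3 *.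
  split.
    rewrite opprD addrA (le_trans (cabs_sub_trans Q _ _))//.
    by rewrite cabs_distC in h2; rewrite [leRHS]mulr_natl mulr2n lerD.
  move=> m; rewrite (le_trans (h3 m))// lerD2r ler_wpM2l ?addr_ge0 ?mulr_ge0//.
  have := cabs_le_dist Q (f t - S); rewrite [cabs (Q - _)]cabs_distC => h4.
  by move: h4 h1; lra.
pose X := fix X k : nat * (nat -> R[i]) * (nat -> R[i]) :=
  if k is k'.+1 then
    let: (n, al, be) := X k' in let: (n', bal, bbe) := next (k', (n, al, be)) in
    (n', fun i => al i + bal i, fun i => be i + bbe i)
  else (0%N, fun=> 0, fun=> 0).
pose n_ k := (X k).1.1; pose al_ k := (X k).1.2; pose be_ k := (X k).2.
pose bal k := (next (k, X k)).1.2; pose bbe k := (next (k, X k)).2.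
have XS k : [/\ n_ k.+1 = (next (k, X k)).1.1,
    al_ k.+1 = (fun i => al_ k i + bal k i) &
    be_ k.+1 = (fun i => be_ k i + bbe k i)].
  rewrite /n_ /al_ /be_ /bal /bbe /=; case: (X k) => [[n al] be] /=.
  by case: (next _) => [[n' b1] b2].
have XP k : [/\ (n_ k < n_ k.+1)%N, supported_on (bal k) (bbe k) (n_ k).+1 (n_ k.+1) &
    off ((16 * pi + 4) / (2 ^ k.+1)%:R)
      (good k (n_ k) (al_ k) (be_ k) (n_ k.+1) (bal k) (bbe k))].
  have [-> _ _] := XS k; rewrite /n_ /al_ /be_ /bal /bbe.
  have := nextP (k, X k); case: (X k) => [[n al] be].
  by case: (next _) => [[n' b1] b2].
have n_mono k k' : (k <= k')%N -> (n_ k <= n_ k')%N.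
  move=> kk'; rewrite -(subnKC kk'); elim: (k' - k)%N => [|j ih].
    by rewrite addn0.
  by rewrite addnS (leq_trans ih)// ltnW//; case: (XP (k + j)%N).
have n_ge k : (k <= n_ k)%N.
  by elim: k => // k ih; rewrite (leq_ltn_trans ih)//; case: (XP k).
have zero_after k i : (n_ k <= i)%N -> al_ k i = 0 /\ be_ k i = 0.
  elim: k => [//|k ih] ki; have [_ -> ->] := XS k; have [nn sb _] := XP k.
  have [-> ->] := ih (leq_trans (ltnW nn) ki).
  by have [|-> ->] := sb i; rewrite ?ki ?orbT// !addr0.
have stable k j i : (i <= n_ k)%N -> al_ (k + j)%N i = al_ k i /\ be_ (k + j)%N i = be_ k i.
  move=> ik; elim: j => [|j [ih1 ih2]]; first by rewrite addn0.
  rewrite addnS; have [_ -> ->] := XS (k + j)%N; rewrite ih1 ih2.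
  have [_ sb _] := XP (k + j)%N.
  have [|-> ->] := sb i; last by rewrite !addr0.
  by rewrite ltnS (leq_trans ik)// n_mono// leq_addr.
(* The diagonal gives the final coefficients: those up to [n_ k] no longer change after stage [k],
   and [i <= n_ i]. *)
pose al i := al_ i i; pose be i := be_ i i.
have alE k i : (i <= n_ k)%N -> al i = al_ k i /\ be i = be_ k i.
  move=> ik; have [ki|ki] := leqP k i.
    by have := stable k (i - k)%N i ik; rewrite subnKC.
  have := stable i (k - i)%N i (n_ge i); rewrite (subnKC (ltnW ki)) => -[e1 e2].
  by split; [exact: esym e1|exact: esym e2].
exists al, be; split => //.
have ser k m t : (n_ k <= m)%N -> (m <= n_ k.+1)%N ->
    series_sum lam al be m t =
    series_sum lam (al_ k) (be_ k) (n_ k) t + series_sum lam (bal k) (bbe k) m t.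
  move=> km mk.
  have -> : series_sum lam al be m t = series_sum lam (al_ k.+1) (be_ k.+1) m t.
    apply: eq_bigr => i _.
    by have [-> ->] := alE k.+1 i (leq_trans (ltnW (ltn_ord i)) mk).
  have [_ -> ->] := XS k; rewrite series_sumD; congr (_ + _).
  by apply: series_sum_tail => // i; exact: zero_after.
have serS k t : series_sum lam (al_ k.+1) (be_ k.+1) (n_ k.+1) t =
    series_sum lam (al_ k) (be_ k) (n_ k) t +
    series_sum lam (bal k) (bbe k) (n_ k.+1) t.
  have [_ -> ->] := XS k; rewrite series_sumD; congr (_ + _).
  apply: series_sum_tail; last by move=> i; exact: zero_after.
  by apply: ltnW; case: (XP k).
have c0 : 0 <= 16 * pi + 4 :> R by rewrite addr_ge0// mulr_ge0// pi_ge0.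
have := @off_borel_cantelli R _ (fun k t =>
  good k (n_ k) (al_ k) (be_ k) (n_ k.+1) (bal k) (bbe k) t) c0.
move=> /(_ (fun k => let: And3 _ _ h := XP k in h)) BC.
apply/eqP; rewrite eq_le outer_measure_ge0 andbT -{1}BC.
apply: le_outer_measure => t [/= nt It]; split => //= -[k0 hk0].
apply: nt => e e0.
(* A generous constant: the final estimate is (2 + 40) 2^-k. *)
have [K KP] := nat_above (79 / e).
pose k1 := maxn k0.+1 K.+1.
exists (n_ k1) => m k1m.
have [k [k1k km mk]] : exists k, [/\ (k1 <= k)%N, (n_ k <= m)%N & (m < n_ k.+1)%N].
  have ex : exists k, (m < n_ k)%N by exists m.+1; exact: n_ge.
  case: (ex_minnP ex) => -[|k] mk kmin; first by move: mk; rewrite ltn0.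
  exists k; split => //.
    rewrite -ltnS ltnNge; apply/negP => kk1.
    by move: mk; rewrite ltnNge (leq_trans (n_mono _ _ kk1)).
  by rewrite leqNgt; apply/negP => /kmin; rewrite ltnn.
have k0k : (k0 < k)%N by move: k1k; rewrite geq_max => /andP[].
have Kk : (K < k)%N by move: k1k; rewrite geq_max => /andP[].
(* Now [m] lies in stage k+1: [good] at k bounds the remainder where it starts, [good] at k+1 the
   partial sums inside it. *)
case: k {k1k} k0k Kk km mk => // k; rewrite ltnS => k0k Kk km mk.
rewrite (ser k.+1)//; last exact: ltnW.
have [g1 _] := hk0 k k0k; rewrite -serS in g1.
have [_ g2] := hk0 k.+1 (leqW k0k).
have {g2} := g2 m; rewrite opprD addrA.
move: g1; set r := f t - series_sum lam _ _ _ _ => g1 g2.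
rewrite (le_trans (cabsB _ _))//.
have y0 : 0 < (2 ^ k)%:R^-1 :> R by rewrite invr_gt0 ltr0n expn_gt0.
have y1 : (2 ^ k)%:R^-1 <= 1 :> R by rewrite invf_le1 ?ltr0n ?expn_gt0// ler1n expn_gt0.
have etaE : eta k = (2 ^ k)%:R^-1 ^+ 2.
  by rewrite /eta exprVn -natrX -expnM mulnC expnM.
have etaSE : eta k.+1 = (2 ^ k)%:R^-1 ^+ 2 / 4.
  by rewrite -etaE /eta expnS natrM invfM mulrC.
have ye : 79 * (2 ^ k)%:R^-1 <= e.
  rewrite ler_pdivrMr ?ltr0n ?expn_gt0// mulrC -ler_pdivrMr//.
  rewrite (le_trans KP)// ler_nat (leq_trans Kk)//.
  exact: ltn_expl.
have g3 : cabs (series_sum lam (bal k.+1) (bbe k.+1) m t) <= 40 * (2 ^ k)%:R^-1.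
  apply: (le_trans g2).
  have kk : (2 ^ k)%:R * (2 ^ k)%:R^-1 = 1 :> R.
    by rewrite divff// pnatr_eq0 -lt0n expn_gt0.
  rewrite expnS natrM etaSE.
  move: g1; rewrite etaE; move: kk y0 y1.
  move: (cabs r) ((2 ^ k)%:R : R) ((2 ^ k)%:R^-1 : R) => c w y wy y0 y1 cy.
  have h1 : (3 + 4 * (2 * w)) * (c + 2 * (y ^+ 2 / 4)) <=
      (3 + 4 * (2 * w)) * (5 / 2 * y ^+ 2).
    have w0 : 0 < w by rewrite -(pmulr_lgt0 _ y0) wy.
    by apply: ler_wpM2l; [clear -w0; lra|clear -cy; lra].
  have h2 : w * y ^+ 2 = y by rewrite expr2 mulrA wy mul1r.
  have h3 : y ^+ 2 <= y by rewrite expr2 ler_piMl// ltW.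
  rewrite (le_trans (lerD h1 (lexx _)))//.
  have -> : (3 + 4 * (2 * w)) * (5 / 2 * y ^+ 2) =
    15 / 2 * y ^+ 2 + 20 * (w * y ^+ 2) by field.
  rewrite h2; lra.
have h3 : eta k <= (2 ^ k)%:R^-1 by rewrite etaE expr2 ler_piMl// ltW.
apply: le_trans (lerD g1 g3) _; apply: le_trans ye; move: h3 y0; lra.
Qed.

End Representation.

(** * From one period to the whole line *)

Section Periodicity.
Variable R : realType.

Lemma measurable_shift (c : R) :
  measurable_fun setT (fun t : measurableTypeR R => t + c : measurableTypeR R).
Proof.
apply: continuous_measurable_fun => t.
by apply: cvgD; [exact: cvg_id|exact: cvg_cst].
Qed.

(** By uniqueness: the image of Lebesgue measure under the shift agrees with it on half-open
    intervals. *)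
Lemma lebesgue_measure_shift (c : R) (A : set R) : measurable A ->
  lebesgue_measure [set t | A (t + c)] = lebesgue_measure A.
Proof.
move=> mA; apply/esym.
have nuE := @lebesgue_measure_unique R
  (measure_function_pushforward__canonical__measure_function_Measure
     (@lebesgue_measure R) (measurable_shift c)).
rewrite nuE// => _ [[a b] _ <-].
rewrite /= /pushforward.
rewrite (_ : _ @^-1` _ = `]a - c, b - c]%classic); last first.
  by apply/seteqP; split => t /=; rewrite !in_itv /= ltrBlDr lerBrDr.
rewrite !lebesgue_measure_itv /= !lte_fin ltrD2r.
by case: ifP => // _; rewrite -!EFinB; congr (_%:E); ring.
Qed.

(** A multiple of 2 pi moves each point of [N] into the period, so countably many translates of one
    null Borel set cover [N]. *)
Lemma null_of_period (N : set R) :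
  (forall (k : int) t, N t -> N (t + k%:~R * (pi *+ 2))) ->
  outer_lebesgue R (N `&` @period_itv R) = 0%E ->
  (@completed_lebesgue_measure R).-negligible N.
Proof.
move=> Nper /negligible_outer_measure[B [mB B0 NB]].
pose sh (k : int) : set R := [set t | B (t + k%:~R * (pi *+ 2))].
pose q n : int := odflt 0 (unpickle n).
have Nsh : N `<=` \bigcup_n sh (q n).
  move=> t Nt.
  have pi20 : (0 : R) < pi *+ 2 by rewrite pmulrn_lgt0 ?pi_gt0.
  pose k : int := - Num.floor (t / (pi *+ 2)).
  exists (pickle k) => //; rewrite /sh /= /q pickleK /=.
  apply: NB; split; first exact: Nper.
  rewrite /period_itv /= in_itv /= /k rmorphN /= mulNr.
  have h1 := floor_le (t / (pi *+ 2)).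
  have h2 := floorD1_gt (t / (pi *+ 2)).
  move: h1 h2; rewrite ler_pdivlMr// intrD ltr_pdivrMr// mulrDl mul1r.
  by move=> h1 h2; apply/andP; split; lra.
suff [A [mA A0 shA]] : (@completed_lebesgue_measure R).-negligible (\bigcup_n sh (q n)).
  by exists A; split => //; exact: subset_trans Nsh shA.
apply: negligible_bigcup => n.
have msh : measurable (sh (q n)).
  rewrite -[X in measurable X]setTI.
  exact: (measurable_shift ((q n)%:~R * (pi *+ 2))).
exists (sh (q n)); split => //; first exact: sub_caratheodory.
transitivity (lebesgue_measure (sh (q n))) => //.
by rewrite lebesgue_measure_shift.
Qed.

Lemma expi_period (l k : int) (t : R) :
  expi (l%:~R * (t + k%:~R * (pi *+ 2))) = expi (l%:~R * t).
Proof.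
have e1 (n : nat) : expi (n%:R * (pi *+ 2)) = 1 :> R[i].
  by rewrite expiMn /expi cos2pi sin2pi expr1n.
rewrite mulrDr expiD mulrA -intrM.
case: (l * k) => n; first by rewrite -pmulrn e1 mulr1.
by rewrite NegzE rmorphN /= mulNr expiN -pmulrn e1 conjc1 mulr1.
Qed.

End Periodicity.

(** * The symmetric spectrum and its partial sums *)

Section Spectrum.
Local Open Scope complex_scope.
Variable R : realType.
Variable lam : nat -> int.
Hypothesis lam_gt0 : forall n, (0 < n)%N -> 0 < lam n.
Hypothesis lamS : forall n, (0 < n)%N -> lam n < lam n.+1.

Definition sym_spectrum : set int :=
  [set k | exists2 n, (0 < n)%N & k = lam n \/ k = - lam n].

Lemma lam_lt m n : (0 < m)%N -> (m < n)%N -> lam m < lam n.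
Proof.
move=> m0; elim: n => // n ih; rewrite ltnS leq_eqVlt => /predU1P[<-|mn].
  exact: lamS.
by rewrite (lt_trans (ih mn))// lamS// (leq_trans _ mn).
Qed.

Lemma lam_inj m n : (0 < m)%N -> (0 < n)%N -> lam m = lam n -> m = n.
Proof.
move=> m0 n0 e; case: (ltngtP m n) => // h.
  by have := lam_lt m0 h; rewrite e ltxx.
by have := lam_lt n0 h; rewrite e ltxx.
Qed.

Lemma lam_ge n : (0 < n)%N -> n%:Z <= lam n.
Proof.
elim: n => // -[|n] ih _; first by have := lam_gt0 (ltn0Sn 0); lia.
by have := ih isT; have := lamS (ltn0Sn n); lia.
Qed.

(** As [lam] is positive and injective, each frequency receives one coefficient. Index 0 lies
    outside the spectrum, hence the vanishing of [al] and [be] there. *)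
Lemma partial_sum_series (al be : nat -> R[i]) : al 0%N = 0 -> be 0%N = 0 ->
  exists c : int -> R[i], forall N m t,
    (forall n, (0 < n)%N -> (n <= m)%N = (`|lam n| <= N)%N) ->
    partial_sum sym_spectrum c N t = series_sum lam al be m.+1 t.
Proof.
move=> al0 be0.
have /choice[c cP] : forall k : int, exists z : R[i],
    (forall n, (0 < n)%N -> k = lam n -> z = al n) /\
    (forall n, (0 < n)%N -> k = - lam n -> z = be n).
  move=> k; have [[n n0 kE]|nk] := pselect (exists2 n, (0 < n)%N & k = lam n).
    exists (al n); split => m m0; rewrite kE; first by move/lam_inj => ->.
    by have := lam_gt0 n0; have := lam_gt0 m0; lia.
  have [[n n0 kE]|nk'] := pselect (exists2 n, (0 < n)%N & k = - lam n).
    exists (be n); split => m m0; last first.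
      by rewrite kE => /oppr_inj/lam_inj ->.
    by rewrite kE; have := lam_gt0 n0; have := lam_gt0 m0; lia.
  exists 0; split => n n0 kE; first by exfalso; apply: nk; exists n.
  by exfalso; apply: nk'; exists n.
exists c => N m t mN.
pose s := map lam (iota 1 m) ++ map (fun n => - lam n) (iota 1 m).
have us : uniq s.
  have ui f : (forall i j : nat, (0 < i)%N -> (0 < j)%N -> f i = f j -> i = j) ->
      uniq (map f (iota 1 m) : seq int).
    move=> fi; rewrite map_inj_in_uniq ?iota_uniq// => i j.
    by rewrite !mem_iota => /andP[i0 _] /andP[j0 _]; exact: fi.
  rewrite cat_uniq !ui//; last 2 first.
  - by move=> i j i0 j0 /oppr_inj; exact: lam_inj.
  - exact: lam_inj.
  rewrite andbT has_map; apply/hasPn => i; rewrite mem_iota => /andP[i0 _].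
  apply/negP => /mapP[j]; rewrite mem_iota => /andP[j0 _].
  by have := lam_gt0 i0; have := lam_gt0 j0; lia.
rewrite /partial_sum (_ : [set k | _] = [set` s]); last first.
  apply/seteqP; split => k /=.
    move=> [[n n0 kE] kN]; rewrite mem_cat; apply/orP.
    have nm : n \in iota 1 m.
      rewrite mem_iota n0 add1n ltnS mN//.
      by case: kE kN => ->; rewrite ?abszN.
    by case: kE => ->; [left|right]; apply/mapP; exists n.
  rewrite mem_cat => /orP[] /mapP[n]; rewrite mem_iota add1n ltnS => /andP[n0 nm] ->.
    by rewrite -mN//; split => //; exists n => //; left.
  by rewrite abszN -mN//; split => //; exists n => //; right.
rewrite -fsbig_seq//.
transitivity (\sum_(k <- s) (c k * expi (k%:~R * t) : R[i])) => //.
rewrite big_cat /= !big_map -big_split /series_sum.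
rewrite -(big_mkord xpredT (fun n => sym_term (al n) (be n) (lam n) t)) big_ltn//.
rewrite [sym_term (al 0%N) _ _ _]/sym_term al0 be0 !mul0r !add0r /=.
rewrite /index_iota subn1 /=.
rewrite big_seq_cond [RHS]big_seq_cond; apply: eq_bigr => n.
rewrite andbT mem_iota => /andP[n0 _]; have [cP1 _] := cP (lam n).
have [_ cP2] := cP (- lam n).
by rewrite /sym_term (cP1 n)// (cP2 n).
Qed.

Lemma sym_spectrum_menshov (eprop : forall f : R -> R[i], L0 f ->
    exists al be : nat -> R[i],
    [/\ al 0%N = 0, be 0%N = 0 &
    outer_lebesgue R (divergence_set lam al be f `&` @period_itv R) = 0%E]) :
  menshov_spectrum R sym_spectrum.
Proof.
move=> f Lf; have [al [be [al0 be0 nul]]] := eprop f Lf.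
have [c cE] := partial_sum_series al0 be0.
exists c.
have fper (k : int) t : f (t + k%:~R * (pi *+ 2)) = f t.
  have [fp _] := Lf.
  have fn n u : f (u + n%:R * (pi *+ 2)) = f u.
    elim: n => [|n ih]; first by rewrite mul0r addr0.
    by rewrite -natr1 mulrDl mul1r addrA fp ih.
  case: k => n; first by rewrite -pmulrn fn.
  rewrite NegzE rmorphN /= -pmulrn -[in RHS](subrK (n.+1%:R * (pi *+ 2)) t).
  by rewrite fn mulNr.
have /null_of_period : forall (k : int) t, divergence_set lam al be f t ->
    divergence_set lam al be f (t + k%:~R * (pi *+ 2)).
  move=> k t /= nt h; apply: nt => e e0; have [m0 hm0] := h e e0.
  exists m0 => m mm0; have := hm0 m mm0; rewrite fper.
  rewrite (_ : series_sum lam al be m (t + _) = series_sum lam al be m t)//.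
  by apply: eq_bigr => n _; rewrite /sym_term !expi_period.
move=> /(_ nul)[A [mA A0 NA]]; exists A; split => // t /= nt.
apply: NA => /= h; apply: nt.
apply/cvgrPdist_le => /= e e0.
(* A positive element of [R[i]] is real, so the complex tolerance reduces to a real one. *)
have [eI eR] : complex.Im e = 0 /\ 0 < complex.Re e.
  by move: e0; rewrite ltcE /= => /andP[/eqP -> ->].
have [m0 hm0] := h _ eR.
near=> N.
have exn : exists n, (N < `|lam n.+1|)%N.
  by exists N; have := lam_ge (ltn0Sn N); lia.
(* Minimality makes [m] the number of indices n > 0 with [lam n <= N], so the cut at [N] is the
   series cut after [m]. *)
case: (ex_minnP exn) => m mN mmin.
have mE n : (0 < n)%N -> (n <= m)%N = (`|lam n| <= N)%N.
  case: n => // n _; apply/idP/idP => [nm|nN].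
    by rewrite leqNgt; apply/negP => /mmin; rewrite leqNgt nm.
  rewrite ltnNge; apply/negP => mn.
  have : lam m.+1 <= lam n.+1.
    move: mn; rewrite leq_eqVlt => /predU1P[->//|mn].
    by apply: ltW; exact: lam_lt.
  have := lam_gt0 (ltn0Sn m); move: nN mN; lia.
rewrite (cE N m t mE) cabsE.
have -> : e = (complex.Re e)%:C by rewrite [e in LHS]complexE eI mulr0 addr0.
rewrite lecR; apply: hm0.
have : (`|lam m0.+1| <= N)%N by near: N; exists `|lam m0.+1|%N.
by rewrite -mE// => h0; exact: leqW (ltnW h0).
Unshelve. all: by end_near.
Qed.

End Spectrum.

Theorem theorem1 (R : realType) (eps : nat -> R)
    (eps_gt0 : forall n : nat, (1 <= n)%N -> 0 < eps n)
    (eps_cvg0 : eps @ \oo --> (0 : R)) :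
  exists L : set int,
    [/\ menshov_spectrum R L,
        [set - k | k in L] = L &
        exists lambda : nat -> int,
          [/\ forall n : nat, (1 <= n)%N -> lambda n < lambda n.+1,
              [set k | L k /\ 0 < k] =
                [set lambda n | n in [set n : nat | (1 <= n)%N]] &
              forall n : nat, (1 <= n)%N ->
                (lambda n.+1)%:~R / (lambda n)%:~R > 1 + eps n]].
Proof.
have /choice[Ds DsP] : forall x : nat * nat, exists Ds : nat * (nat -> int),
    (0 < x.1)%N -> good_window R x.1 x.2 Ds.1 Ds.2.
  move=> [e p]; have [e0|e0] := posnP e.
    by exists (0%N, fun=> 0); rewrite /= e0.
  by have [D [sigma h]] := window_exists R p e0; exists (D, sigma).
(* Every pair (e, p) with e > 0 is the type of a window, and p is unbounded for
   each e, so windows of type (e, _) occur arbitrarily far. *)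
pose type w := ((logn 2 w.+1).+1, logn 3 w.+1).
have [lam [lam_gt0 lam_gap lam_win]] := lacunary_with_windows
  (fun w => (Ds (type w)).1) (fun w => (Ds (type w)).2) eps_cvg0.
have lamS n : (0 < n)%N -> lam n < lam n.+1.
  move=> n0; rewrite -(ltr_int R); apply: le_lt_trans (lam_gap n n0).
  by rewrite ler_peMl ?ler0z ?(ltW (lam_gt0 n n0))// lerDl ltW// eps_gt0.
exists (sym_spectrum lam); split.
- apply: sym_spectrum_menshov => // f Lf; apply: representation => //.
  apply: (@approx_step R lam (fun e p => (Ds (e, p)).1) (fun e p => (Ds (e, p)).2)).
    by move=> e p e0; exact: (DsP (e, p)).
  (* Including [n0] in the maximum pushes the window beyond [n0]: w + 1 >= 3^p' > n0 and N >= w. *)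
  move=> e p n0 e0; pose p' := maxn p n0.
  pose w := (2 ^ e.-1 * 3 ^ p').-1.
  have wE : w.+1 = (2 ^ e.-1 * 3 ^ p')%N by rewrite prednK// muln_gt0 !expn_gt0.
  have tw : type w = (e, p').
    rewrite /type wE !lognM ?expn_gt0// !pfactorK// !lognX.
    by rewrite !(logn_prime)//= !muln0 !addn0 add0n prednK.
  have [N wN] := lam_win w; rewrite tw => hN.
  exists p', N; split => //; first by rewrite leq_maxl.
  apply: leq_trans wN; rewrite -ltnS wE.
  apply: (@leq_trans (3 ^ p')); last by rewrite leq_pmull// expn_gt0.
  by rewrite (leq_ltn_trans (leq_maxr p n0))// ltn_expl.
- apply/seteqP; split => k /=.
    by move=> [_ [n n0 [->|->]] <-]; exists n => //; [right|left; rewrite opprK].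
  by move=> [n n0 kE]; exists (- k); rewrite ?opprK//; exists n => //;
    case: kE => ->; [right|left; rewrite opprK].
- exists lam; split => //.
  + apply/seteqP; split => k /=.
      move=> [[n n0 [->|->]] k0]; first by exists n.
      by have := lam_gt0 n n0; lia.
    by move=> [n n0 <-]; split; [exists n => //; left|exact: lam_gt0].
  + move=> n n0; rewrite ltr_pdivlMr ?ltr0z ?lam_gt0//; exact: lam_gap.
Qed.
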